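(* Let $K$ be a complete discretely valued field with ring of integers $\mathcal{O}_K$, uniformiser $\pi$ and residue field $\mathbb{F}=\mathcal{O}_K/\pi\mathcal{O}_K$. Let $G$ be a compact group, $V$ a finite-dimensional $K$-vector space and $\rho\colon G\to \mathrm{GL}(V)$ a continuous irreducible representation. Write $\overline{\rho}^{ss}=\bigoplus_{i=1}^r W_i^{m_i}$ with $W_1,\dots,W_r$ pairwise non-isomorphic irreducible representations of $G$ over $\mathbb{F}$ and $m_i\ge 1$. Then: (1) for each $i=1,\dots,r$ there exists a maximal $\rho(G)$-stable lattice $\Lambda_i\subset V$ with $\mathrm{soc}(\Lambda_i/\pi\Lambda_i)\simeq W_i$; (2) for every $j=1,\dots,r$, if $W_j$ occurs in the $m$-th level of the socle filtration of $\Lambda_i/\pi\Lambda_i$ (for a lattice $\Lambda_i$ as in (1)), then there is a directed path of length $m-1$ in $\Gamma_\rho$ from $W_i$ to $W_j$. In particular, $\Gamma_\rho$ is connected as a directed graph: for any two vertices $W_i,W_j$ there is a directed path from $W_i$ to $W_j$.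
   Context: A lattice in $V$ is a free $\mathcal{O}_K$-submodule of rank $\dim_K V$; it is $\rho(G)$-stable if $\rho(g)\Lambda=\Lambda$ for all $g\in G$ (such lattices exist since $G$ is compact and $\rho$ continuous). For a stable lattice $\Lambda$, $\Lambda/\pi\Lambda$ is a finite-dimensional representation of $G$ over $\mathbb{F}$; its semisimplification $\overline{\rho}^{ss}$ is independent of $\Lambda$. For nonzero $v\in V$, a lattice $\Lambda$ is normalised at $v$ if $v\in\Lambda$ and the image of $v$ in $\Lambda/\pi\Lambda$ is nonzero; $\mathcal{L}_v$ denotes the set of $\rho(G)$-stable lattices normalised at $v$, partially ordered by inclusion. A stable lattice is maximal with respect to $v$ if it is a maximal element of $\mathcal{L}_v$, and is maximal if it is maximal with respect to some nonzero $v\in V$. The socle filtration of a finite-dimensional $\mathbb{F}[G]$-module $\overline V$ is $0=\mathrm{soc}^0(\overline V)\subsetneq \mathrm{soc}^1(\overline V)\subsetneq\cdots\subsetneq \mathrm{soc}^{\ell}(\overline V)=\overline V$ where $\mathrm{soc}^k(\overline V)/\mathrm{soc}^{k-1}(\overline V)=\mathrm{soc}(\overline V/\mathrm{soc}^{k-1}(\overline V))$; an irreducible $W$ occurs in the $k$-th level if $W$ is isomorphic to a subrepresentation of $\mathrm{soc}^k(\overline V)/\mathrm{soc}^{k-1}(\overline V)$. An extension of $W_i$ by $W_j$ is a representation $U$ with a short exact sequence $0\to W_j\to U\to W_i\to 0$. We say $\rho$ realises a non-split extension of $W_i$ by $W_j$ if there is a stable lattice $\Lambda$ and subrepresentations $U_0\subseteq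 U_1\subseteq \Lambda/\pi\Lambda$ such that $U_1/U_0$ is a non-split extension of $W_i$ by $W_j$. Bellaïche's graph $\Gamma_\rho$ is the directed graph with vertices $W_1,\dots,W_r$ and a directed edge from $W_j$ to $W_i$ whenever $\rho$ realises a non-split extension of $W_i$ by $W_j$. *)

(* Defs.v *)
From HB Require Import structures.
From mathcomp Require Import all_boot all_order all_algebra.
From mathcomp Require Import generic_quotient ring_quotient.
From mathcomp Require Import boolp classical_sets functions filter topology.

Set Implicit Arguments.
Unset Strict Implicit.
Unset Printing Implicit Defensive.
Import Order.TTheory GRing.Theory Num.Theory.
Local Open Scope classical_set_scope.
Local Open Scope quotient_scope.
Local Open Scope ring_scope.

Identity Coercion set_Funclass : set >-> Funclass.

HB.mixin Record Group_isTopGroup G & Group G & Topological G := {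
  mulg_continuous : continuous (fun x : G * G => (x.1 * x.2)%g);
  invg_continuous : continuous (fun x : G => (x^-1)%g) }.

#[short(type="topGroupType")]
HB.structure Definition TopGroup :=
  {G of Group G & Topological G & Group_isTopGroup G}.

(* Representations of an abstract group on left modules over a ring. The same
   notion is used over a field K, its ring of integers and its residue field. *)

Record repn (R : nzRingType) (G : groupType) (M : lmodType R) := Repn {
  act :> G -> {linear M -> M};
  act1 : forall x, act 1%g x = x;
  actM : forall g h x, act (g * h)%g x = act g (act h x) }.

Record rep (R : nzRingType) (G : groupType) := Rep {
  rep_mod : lmodType R;
  rep_act : repn G rep_mod }.
Coercion rep_mod : rep >-> GRing.Lmodule.type.

Section Representations.
Variables (R : nzRingType) (G : groupType).
Implicit Types M N W : rep R G.

Definition equivariant M N (f : M -> N) :=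
  forall g x, f (rep_act M g x) = rep_act N g (f x).

Definition riso M N :=
  exists f : {linear M -> N}, equivariant f /\ bijective f.

Record subrep M := Subrep {
  subrep_set :> set M;
  subrep0 : subrep_set 0;
  subrepD : forall x y, subrep_set x -> subrep_set y -> subrep_set (x + y);
  subrepZ : forall a x, subrep_set x -> subrep_set (a *: x);
  subrepG : forall g x, subrep_set x -> subrep_set (rep_act M g x) }.

Definition irreducible M :=
  (exists x : M, x != 0) /\
  forall U : subrep M, (U = [set 0] :> set M) \/ (U = [set: M] :> set M).

Section Sub.
Variables (M : rep R G) (U : subrep M).

Definition subrep_pred : {pred M} := fun x => `[< U x >].

Lemma subrep_predE x : (x \in subrep_pred) = `[< U x >]. Proof. by []. Qed.

Lemma subrep_submod_closed : submod_closed subrep_pred.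
Proof.
split=> [|a x y]; rewrite !subrep_predE; first exact/asboolP/subrep0.
by move=> /asboolP Ux /asboolP Uy; apply/asboolP/subrepD => //; exact: subrepZ.
Qed.
HB.instance Definition _ :=
  GRing.isSubmodClosed.Build R M subrep_pred subrep_submod_closed.

Definition srep_type := {x : M | x \in subrep_pred}.
HB.instance Definition _ := SubChoice.on srep_type.
HB.instance Definition _ := [SubChoice_isSubLmodule of srep_type by <:].

Lemma srep_subproof g (x : srep_type) : rep_act M g (val x) \in subrep_pred.
Proof. by apply/asboolP/subrepG/asboolP; exact: valP x. Qed.

Definition srep_fun g (x : srep_type) : srep_type :=
  Sub (rep_act M g (val x)) (srep_subproof g x).

Lemma srep_fun_linear g : linear (srep_fun g).
Proof. by move=> a x y; apply: val_inj; rewrite /= !linearP. Qed.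
HB.instance Definition _ g :=
  GRing.isLinear.Build R srep_type srep_type _ (srep_fun g) (srep_fun_linear g).

Lemma srep1 x : srep_fun 1%g x = x.
Proof. by apply: val_inj; rewrite /= act1. Qed.

Lemma srepM g h x : srep_fun (g * h)%g x = srep_fun g (srep_fun h x).
Proof. by apply: val_inj; rewrite /= actM. Qed.

Definition srep : rep R G :=
  Rep (@Repn _ _ srep_type (fun g => srep_fun g) srep1 srepM).

Definition qrep_type := {ideal_quot subrep_pred}.
HB.instance Definition _ := GRing.Zmodule.on qrep_type.
HB.instance Definition _ := EqQuotient.on qrep_type.

Definition qrep_pi (x : M) : qrep_type := \pi_{ideal_quot subrep_pred} x.

Lemma qrep_piP x y : qrep_pi x = qrep_pi y <-> U (x - y).
Proof.
rewrite /qrep_pi; split=> [/eqP|Uxy]; last apply/eqP.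
  by rewrite -Quotient.idealrBE => /asboolP.
by rewrite -Quotient.idealrBE; apply/asboolP.
Qed.

Lemma qrep_pi_repr (x : qrep_type) : qrep_pi (repr x) = x.
Proof. exact: reprK. Qed.

Lemma qrep_pi_zmod : zmod_morphism qrep_pi.
Proof. exact: (raddfB (\pi_{ideal_quot subrep_pred})). Qed.
HB.instance Definition _ :=
  GRing.isZmodMorphism.Build M qrep_type qrep_pi qrep_pi_zmod.

Definition qrep_scale (a : R) (x : qrep_type) : qrep_type :=
  qrep_pi (a *: repr x).

Lemma qrep_scaleE a x : qrep_scale a (qrep_pi x) = qrep_pi (a *: x).
Proof.
apply/qrep_piP; rewrite -scalerBr; apply/subrepZ/qrep_piP.
exact: qrep_pi_repr.
Qed.

Lemma qrep_scaleA a b x :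
  qrep_scale a (qrep_scale b x) = qrep_scale (a * b) x.
Proof. by rewrite -(qrep_pi_repr x) !qrep_scaleE scalerA. Qed.

Lemma qrep_scale1 : left_id 1 qrep_scale.
Proof. by move=> x; rewrite -(qrep_pi_repr x) qrep_scaleE scale1r. Qed.

Lemma qrep_scaleDr : right_distributive qrep_scale +%R.
Proof.
move=> a x y; rewrite -(qrep_pi_repr x) -(qrep_pi_repr y) -raddfD.
by rewrite !qrep_scaleE scalerDr raddfD.
Qed.

Lemma qrep_scaleDl x : {morph qrep_scale^~ x : a b / a + b}.
Proof.
by move=> a b; rewrite -(qrep_pi_repr x) !qrep_scaleE scalerDl raddfD.
Qed.
HB.instance Definition _ := GRing.Zmodule_isLmodule.Build R qrep_type
  qrep_scaleA qrep_scale1 qrep_scaleDr qrep_scaleDl.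

Lemma qrep_pi_linear : scalable qrep_pi.
Proof. by move=> a x; exact/esym/qrep_scaleE. Qed.
HB.instance Definition _ :=
  GRing.isScalable.Build R M qrep_type _ qrep_pi qrep_pi_linear.

Definition qrep_fun g (x : qrep_type) : qrep_type :=
  qrep_pi (rep_act M g (repr x)).

Lemma qrep_funE g x : qrep_fun g (qrep_pi x) = qrep_pi (rep_act M g x).
Proof.
apply/qrep_piP; rewrite -linearB; apply/subrepG/qrep_piP.
exact: qrep_pi_repr.
Qed.

Lemma qrep_fun_linear g : linear (qrep_fun g).
Proof.
move=> a x y; rewrite -(qrep_pi_repr x) -(qrep_pi_repr y) -linearP.
by rewrite !qrep_funE !linearP.
Qed.
HB.instance Definition _ g :=
  GRing.isLinear.Build R qrep_type qrep_type _ (qrep_fun g) (qrep_fun_linear g).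

Lemma qrep1 x : qrep_fun 1%g x = x.
Proof. by rewrite -(qrep_pi_repr x) qrep_funE act1. Qed.

Lemma qrepM g h x : qrep_fun (g * h)%g x = qrep_fun g (qrep_fun h x).
Proof. by rewrite -(qrep_pi_repr x) !qrep_funE actM. Qed.

Definition qrep : rep R G :=
  Rep (@Repn _ _ qrep_type (fun g => qrep_fun g) qrep1 qrepM).

Definition subrep_pre (Q : subrep qrep) : subrep M.
Proof.
exists [set x | Q (qrep_pi x)] => /=.
- by rewrite raddf0; exact: (subrep0 Q).
- by move=> x y Qx Qy; rewrite raddfD; exact: (subrepD Qx Qy).
- by move=> a x Qx; rewrite linearZ; exact: (subrepZ a Qx).
- by move=> g x Qx; rewrite -qrep_funE; exact: (subrepG g Qx).
Defined.

Definition subrep_restr (U0 : subrep M) : subrep srep.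
Proof.
exists [set x | U0 (val x)] => /=.
- exact: subrep0.
- by move=> x y; exact: subrepD.
- by move=> a x; exact: subrepZ.
- by move=> g x; exact: subrepG.
Defined.

End Sub.

(* The subquotient U1 / U0; only meant for U0 included in U1. *)
Definition subquo M (U1 U0 : subrep M) : rep R G := qrep (subrep_restr U1 U0).

Definition subrep_zero M : subrep M.
Proof.
exists [set 0] => //= [x y -> ->|a x ->|g x ->].
- by rewrite addr0.
- by rewrite scaler0.
- by rewrite linear0.
Defined.

Section DirectSum.
Variables (I : finType) (N : I -> rep R G).

Definition dsum_type := forall i, N i.
HB.instance Definition _ := gen_eqMixin dsum_type.
HB.instance Definition _ := gen_choiceMixin dsum_type.

Definition dsum_add (x y : dsum_type) : dsum_type := fun i => x i + y i.
Definition dsum_opp (x : dsum_type) : dsum_type := fun i => - x i.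
Definition dsum_zero : dsum_type := fun i => 0.
Definition dsum_scale a (x : dsum_type) : dsum_type := fun i => a *: x i.

Lemma dsum_addA : associative dsum_add.
Proof. by move=> x y z; apply: functional_extensionality_dep => i; exact: addrA. Qed.
Lemma dsum_addC : commutative dsum_add.
Proof. by move=> x y; apply: functional_extensionality_dep => i; exact: addrC. Qed.
Lemma dsum_add0 : left_id dsum_zero dsum_add.
Proof. by move=> x; apply: functional_extensionality_dep => i; exact: add0r. Qed.
Lemma dsum_addN : left_inverse dsum_zero dsum_opp dsum_add.
Proof. by move=> x; apply: functional_extensionality_dep => i; exact: addNr. Qed.
HB.instance Definition _ := GRing.isZmodule.Build dsum_type
  dsum_addA dsum_addC dsum_add0 dsum_addN.

Lemma dsum_scaleA a b x : dsum_scale a (dsum_scale b x) = dsum_scale (a * b) x.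
Proof. by apply: functional_extensionality_dep => i; exact: scalerA. Qed.
Lemma dsum_scale1 : left_id 1 dsum_scale.
Proof. by move=> x; apply: functional_extensionality_dep => i; exact: scale1r. Qed.
Lemma dsum_scaleDr : right_distributive dsum_scale +%R.
Proof.
by move=> a x y; apply: functional_extensionality_dep => i; exact: scalerDr.
Qed.
Lemma dsum_scaleDl x : {morph dsum_scale^~ x : a b / a + b}.
Proof.
by move=> a b; apply: functional_extensionality_dep => i; exact: scalerDl.
Qed.
HB.instance Definition _ := GRing.Zmodule_isLmodule.Build R dsum_type
  dsum_scaleA dsum_scale1 dsum_scaleDr dsum_scaleDl.

Definition dsum_fun g (x : dsum_type) : dsum_type :=
  fun i => rep_act (N i) g (x i).

Lemma dsum_fun_linear g : linear (dsum_fun g).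
Proof.
move=> a x y; apply: functional_extensionality_dep => i.
exact: (linearP (rep_act (N i) g)).
Qed.
HB.instance Definition _ g :=
  GRing.isLinear.Build R dsum_type dsum_type _ (dsum_fun g) (dsum_fun_linear g).

Lemma dsum1 x : dsum_fun 1%g x = x.
Proof. by apply: functional_extensionality_dep => i; exact: act1. Qed.

Lemma dsumM g h x : dsum_fun (g * h)%g x = dsum_fun g (dsum_fun h x).
Proof. by apply: functional_extensionality_dep => i; exact: actM. Qed.

Definition dsum : rep R G :=
  Rep (@Repn _ _ dsum_type (fun g => dsum_fun g) dsum1 dsumM).

End DirectSum.

Definition rpow W (n : nat) : rep R G := dsum (fun _ : 'I_n => W).

(* The socle: the sum of all irreducible subrepresentations. *)
Definition soc M : subrep M.
Proof.
exists [set x | exists n (U : 'I_n -> subrep M) (y : 'I_n -> M),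
  (forall i, irreducible (srep (U i)) /\ U i (y i)) /\ x = \sum_(i < n) y i].
- exists 0%N, (fun _ => subrep_zero M), (fun _ => 0).
  by split=> [[]//|]; rewrite big_ord0.
- move=> _ _ [m [U [x [Ux ->]]]] [n [T [y [Ty ->]]]].
  exists (m + n)%N, (fun i => match fintype.split i with inl j => U j | inr j => T j end),
    (fun i => match fintype.split i with inl j => x j | inr j => y j end).
  split=> [i|]; first by case: splitP.
  rewrite big_split_ord /=; congr (_ + _); apply: eq_bigr => i _.
    by rewrite (unsplitK (inl i)).
  by rewrite (unsplitK (inr i)).
- move=> a _ [n [U [y [Uy ->]]]]; exists n, U, (fun i => a *: y i).
  split=> [i|]; last by rewrite scaler_sumr.
  by have [irrU Ui] := Uy i; split=> //; exact: subrepZ.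
- move=> g _ [n [U [y [Uy ->]]]]; exists n, U, (fun i => rep_act M g (y i)).
  split=> [i|]; last by rewrite linear_sum.
  by have [irrU Ui] := Uy i; split=> //; exact: subrepG.
Defined.

Fixpoint soc_filt M (k : nat) : subrep M :=
  if k is k'.+1 then subrep_pre (soc (qrep (soc_filt M k'))) else subrep_zero M.

(* Levels are numbered from 1. *)
Definition occurs_in_level W M (k : nat) :=
  (0 < k)%N /\
  exists U : subrep (subquo (soc_filt M k) (soc_filt M k.-1)), riso W (srep U).

Definition nonsplit_extension (Wi Wj U : rep R G) :=
  exists (f : {linear Wj -> U}) (p : {linear U -> Wi}),
    [/\ equivariant f, equivariant p, injective f,
        (forall z, exists x, p x = z) &
        (forall x, p x = 0 <-> exists y, x = f y)] /\
    ~ exists s : {linear Wi -> U}, equivariant s /\ cancel s p.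

Record comp_series M := CompSeries {
  cs_len : nat;
  cs :> nat -> subrep M;
  cs_bot : cs 0%N = [set 0] :> set M;
  cs_top : cs cs_len = [set: M] :> set M;
  cs_sub : forall k, (k < cs_len)%N -> cs k `<=` cs k.+1;
  cs_irr : forall k, (k < cs_len)%N -> irreducible (subquo (cs k.+1) (cs k)) }.

Definition graded M (C : comp_series M) : rep R G :=
  dsum (fun k : 'I_(cs_len C) => subquo (C k.+1) (C k)).

(* Well defined up to isomorphism by the Jordan-Hoelder theorem; the value on
   representations without a composition series is irrelevant. *)
Definition semisimplification M : rep R G :=
  match pselect (exists C : comp_series M, True) with
  | left h => graded (sval (cid h))
  | right _ => M
  end.

End Representations.

(* A normalised discrete valuation; its value at 0 is irrelevant. *)
Record dvaluation (K : fieldType) := DValuation {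
  dval :> K -> int;
  dvalM : forall x y, x != 0 -> y != 0 -> dval (x * y) = dval x + dval y;
  dvalD : forall x y, x != 0 -> y != 0 -> x + y != 0 ->
    Num.min (dval x) (dval y) <= dval (x + y);
  dval_surj : exists2 x, x != 0 & dval x = 1 }.

Record uniformizer (K : fieldType) (v : dvaluation K) := Uniformizer {
  unif :> K;
  unif_neq0 : unif != 0;
  unif_val : v unif = 1 }.

Section Valuation.
Variables (K : fieldType) (v : dvaluation K).

Definition val_ge (n : int) (x : K) : bool := (x == 0) || (n <= v x).

Lemma dval1 : v 1 = 0.
Proof.
have /eqP := dvalM v (oner_neq0 K) (oner_neq0 K).
by rewrite mulr1 -subr_eq0 opprD addNKr oppr_eq0 => /eqP.
Qed.

Lemma dvalN1 : v (-1) = 0.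
Proof.
have N1 : -1 != 0 :> K by rewrite oppr_eq0 oner_eq0.
have := dvalM v N1 N1; rewrite mulrNN mulr1 dval1 => /esym/eqP.
by rewrite -mulr2n mulrn_eq0 => /eqP.
Qed.

Lemma val_geM m n x y : val_ge m x -> val_ge n y -> val_ge (m + n) (x * y).
Proof.
rewrite /val_ge mulf_eq0; have [//|x0] := eqVneq x 0.
have [//|y0] /= := eqVneq y 0; rewrite dvalM // => *; exact: lerD.
Qed.

Lemma val_geD n x y : val_ge n x -> val_ge n y -> val_ge n (x + y).
Proof.
rewrite /val_ge; have [->|x0] := eqVneq x 0; first by rewrite add0r.
have [->|y0] := eqVneq y 0; first by rewrite addr0 (negPf x0).
have [//|xy0] /= := eqVneq (x + y) 0 => nx ny.
by apply: le_trans (dvalD v x0 y0 xy0); rewrite le_min nx.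
Qed.

Lemma val_geN n x : val_ge n x -> val_ge n (- x).
Proof.
move=> nx; rewrite -mulN1r -[n]add0r; apply: val_geM => //.
by rewrite /val_ge dvalN1 lexx orbT.
Qed.

Lemma val_ge_le m n x : m <= n -> val_ge n x -> val_ge m x.
Proof.
by move=> mn; rewrite /val_ge => /orP[->//|/(le_trans mn)->]; rewrite orbT.
Qed.

(* K with the uniform structure (hence the topology) defined by v. *)
Definition valued (w : dvaluation K) : Type := K.
HB.instance Definition _ := Choice.on (valued v).
HB.instance Definition _ := isPointed.Build (valued v) (0 : K).

Local Open Scope relation_scope.

Definition val_ent : set_system (valued v * valued v) :=
  filter_from [set: int] (fun n => [set xy | val_ge n ((xy.1 : K) - xy.2)]).

Lemma val_ent_filter : Filter val_ent.
Proof.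
apply: filter_from_filter; first by exists 0.
move=> m n _ _; exists (Num.max m n) => // xy /= h.
by split; apply: val_ge_le h; rewrite le_max lexx ?orbT.
Qed.

Lemma val_ent_diag A : val_ent A -> diagonal `<=` A.
Proof.
move=> [n _ sA] [x y] /= xy; apply: sA => /=.
have -> : x = y by [].
by rewrite /val_ge subrr eqxx.
Qed.

Lemma val_ent_inv A : val_ent A -> val_ent A^-1.
Proof.
move=> [n _ sA]; exists n => // -[x y] /= h; apply: sA => /=.
by rewrite -opprB; exact: val_geN.
Qed.

Lemma val_ent_split A : val_ent A -> exists2 B, val_ent B & B \; B `<=` A.
Proof.
move=> [n _ sA]; exists [set xy | val_ge n ((xy.1 : K) - xy.2)]; first by exists n.
move=> [x y] [z /= xz zy]; apply: sA => /=.
by rewrite -(subrKA z (x : K)); exact: val_geD.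
Qed.

HB.instance Definition _ := isUniform.Build (valued v)
  val_ent_filter val_ent_diag val_ent_inv val_ent_split.

Definition complete_valued :=
  forall F : set_system (valued v), ProperFilter F -> cauchy F -> cvg F.

Local Close Scope relation_scope.

Definition integers : {pred K} := val_ge 0.

Lemma integers_subring : subring_closed integers.
Proof.
split=> [|x y Ox Oy|x y]; first by rewrite /in_mem/= /integers /val_ge dval1 orbT.
- by apply: val_geD => //; exact: val_geN.
- exact: val_geM.
Qed.
HB.instance Definition _ :=
  GRing.isSubringClosed.Build K integers integers_subring.

Definition OK := {x : K | x \in integers}.
HB.instance Definition _ := SubChoice.on OK.
HB.instance Definition _ := [SubChoice_isSubComNzRing of OK by <:].

Variable pi : uniformizer v.

Lemma unif_int : (pi : K) \in integers.
Proof. by rewrite /in_mem/= /integers /val_ge unif_val orbT. Qed.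

Definition unifO : OK := Sub (pi : K) unif_int.

Definition pi_ideal : {pred OK} := fun x => `[< exists y, x = unifO * y >].

Lemma pi_idealP (x : OK) : reflect (exists y, x = unifO * y) (x \in pi_ideal).
Proof. exact: asboolP. Qed.

Lemma pi_ideal_closed : idealr_closed pi_ideal.
Proof.
split.
- by apply/pi_idealP; exists 0; rewrite mulr0.
- apply/pi_idealP => -[y /(congr1 val)]; rewrite rmorph1 rmorphM /= => y1.
  have y0 : val y != 0.
    by apply/eqP => y0; move: y1; rewrite y0 mulr0 => /eqP; rewrite oner_eq0.
  have /(congr1 v) := y1; rewrite dvalM ?unif_neq0// dval1 unif_val => /eqP.
  have := valP y; rewrite /in_mem/= /integers /val_ge (negPf y0) /= => vy.
  by rewrite eq_sym gt_eqF // ltr_pwDl.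
- move=> a _ _ /pi_idealP[x ->] /pi_idealP[y ->]; apply/pi_idealP.
  by exists (a * x + y); rewrite mulrDr mulrCA.
Qed.
HB.instance Definition _ := isIdealr.Build OK pi_ideal pi_ideal_closed.

Definition residue := {ideal_quot pi_ideal}.
HB.instance Definition _ := GRing.ComNzRing.on residue.

Definition residue_pi (x : OK) : residue := \pi_{ideal_quot pi_ideal} x.

Lemma residue_piP x y : residue_pi x = residue_pi y <-> x - y \in pi_ideal.
Proof.
rewrite /residue_pi; split=> [/eqP|h]; last apply/eqP;
by rewrite -Quotient.idealrBE.
Qed.

Lemma residue_pi_repr (x : residue) : residue_pi (repr x) = x.
Proof. exact: reprK. Qed.

Lemma residue_pi_zmod : zmod_morphism residue_pi.
Proof. exact: (raddfB (\pi_{ideal_quot pi_ideal})). Qed.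
Lemma residue_pi_monoid : monoid_morphism residue_pi.
Proof.
split; [exact: (rmorph1 (\pi_{ideal_quot pi_ideal}))|].
exact: (rmorphM (\pi_{ideal_quot pi_ideal})).
Qed.
HB.instance Definition _ :=
  GRing.isZmodMorphism.Build OK residue residue_pi residue_pi_zmod.
HB.instance Definition _ :=
  GRing.isMonoidMorphism.Build OK residue residue_pi residue_pi_monoid.

Lemma residue_inv_ex (x : residue) : exists y, (x != 0 -> y * x = 1) /\ (x = 0 -> y = 0).
Proof.
have [->|x0] := eqVneq x 0; first by exists 0; split; rewrite ?eqxx.
rewrite -(residue_pi_repr x) in x0 *; move: (repr x) x0 => a a0.
have va : ~~ val_ge 1 (val a).
  apply: contra a0 => va; rewrite -(rmorph0 residue_pi); apply/eqP/residue_piP.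
  have Oa : val a / unif pi \in integers.
    have := val_geM va (_ : val_ge (-1) (unif pi)^-1); rewrite subrr; apply.
    rewrite /val_ge invr_eq0 (negPf (unif_neq0 pi)) /=.
    have := dvalM v (unif_neq0 pi) (invr_neq0 (unif_neq0 pi)).
    by rewrite divff ?unif_neq0 // dval1 unif_val => /esym/eqP; rewrite addrC addr_eq0 => /eqP->.
  apply/pi_idealP; exists (Sub (val a / unif pi) Oa); apply: val_inj.
  by rewrite subr0 rmorphM /= mulrC divfK // unif_neq0.
move: va; rewrite /val_ge negb_or -ltNge => /andP[a0' va].
have Oa : (val a)^-1 \in integers.
  have := dvalM v a0' (invr_neq0 a0'); rewrite divff // dval1 => /esym/eqP.
  have := valP a; rewrite /in_mem/= /integers /val_ge (negPf a0') /= => va0.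
  rewrite addrC addr_eq0 => /eqP va'.
  rewrite /in_mem/= /integers /val_ge invr_eq0 (negPf a0') /= va'.
  by rewrite oppr_ge0 -ltzD1 add0r.
exists (residue_pi (Sub (val a)^-1 Oa)).
split=> [_|a0'']; last by rewrite a0'' eqxx in a0.
rewrite -rmorphM -(rmorph1 residue_pi).
by congr residue_pi; apply: val_inj; rewrite rmorphM rmorph1 /= mulVf.
Qed.

Definition residue_inv (x : residue) : residue := sval (cid (residue_inv_ex x)).

Lemma residue_mulVf (x : residue) : x != 0 -> residue_inv x * x = 1.
Proof. exact: (svalP (cid (residue_inv_ex x))).1. Qed.

Lemma residue_inv0 : residue_inv 0 = 0.
Proof. exact: (svalP (cid (residue_inv_ex 0))).2. Qed.
HB.instance Definition _ :=
  GRing.ComNzRing_isField.Build residue residue_mulVf residue_inv0.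

End Valuation.

Section Reduction.
Variables (K : fieldType) (v : dvaluation K) (pi : uniformizer v).
Variable (G : groupType).
Local Notation O := (OK v).
Local Notation FF := (residue pi).

Section ModPi.
Variable N : rep O G.

Definition pi_sub : subrep N.
Proof.
exists [set x | exists y, x = unifO pi *: y] => /=.
- by exists 0; rewrite scaler0.
- by move=> _ _ [x ->] [y ->]; exists (x + y); rewrite scalerDr.
- by move=> a _ [x ->]; exists (a *: x); rewrite !scalerA mulrC.
- by move=> g _ [x ->]; exists (rep_act N g x); rewrite linearZ.
Defined.

(* N / pi N, with the induced structure of vector space over O / pi O. *)
Definition modpi_type : Type := qrep_type pi_sub.
HB.instance Definition _ := GRing.Zmodule.on modpi_type.

Definition modpi (x : N) : modpi_type := qrep_pi pi_sub x.

Definition modpi_scale (a : FF) (x : modpi_type) : modpi_type :=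
  (repr a : O) *: (x : qrep_type pi_sub).

Lemma modpi_scaleE a x :
  modpi_scale (residue_pi pi a) x = a *: (x : qrep_type pi_sub).
Proof.
rewrite /modpi_scale; set b := repr _; apply/eqP; rewrite -subr_eq0 -scalerBl.
have /residue_piP/pi_idealP[c ->] : residue_pi pi b = residue_pi pi a.
  exact: residue_pi_repr.
rewrite -(qrep_pi_repr x) -linearZ -(raddf0 (qrep_pi pi_sub)).
by apply/eqP/qrep_piP; exists (c *: repr x); rewrite subr0 scalerA.
Qed.

Lemma modpi_scaleA a b x : modpi_scale a (modpi_scale b x) = modpi_scale (a * b) x.
Proof.
rewrite -(residue_pi_repr a) -(residue_pi_repr b) -rmorphM !modpi_scaleE.
exact: scalerA.
Qed.

Lemma modpi_scale1 : left_id 1 modpi_scale.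
Proof. by move=> x; rewrite -(rmorph1 (residue_pi pi)) modpi_scaleE scale1r. Qed.

Lemma modpi_scaleDr : right_distributive modpi_scale +%R.
Proof. by move=> a x y; exact: scalerDr. Qed.

Lemma modpi_scaleDl x : {morph modpi_scale^~ x : a b / a + b}.
Proof.
move=> a b; rewrite -(residue_pi_repr a) -(residue_pi_repr b) -rmorphD.
by rewrite !modpi_scaleE; exact: scalerDl.
Qed.
HB.instance Definition _ := GRing.Zmodule_isLmodule.Build FF modpi_type
  modpi_scaleA modpi_scale1 modpi_scaleDr modpi_scaleDl.

Definition modpi_fun g (x : modpi_type) : modpi_type := qrep_fun g x.

Lemma modpi_fun_linear g : linear (modpi_fun g).
Proof.
move=> a x y; rewrite -(residue_pi_repr a).
exact: (linearP (qrep_fun (U := pi_sub) g)).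
Qed.
HB.instance Definition _ g := GRing.isLinear.Build FF modpi_type modpi_type _
  (modpi_fun g) (modpi_fun_linear g).

Definition modpi_rep : rep FF G :=
  Rep (@Repn _ _ modpi_type (fun g => modpi_fun g)
    (qrep1 (U := pi_sub)) (qrepM (U := pi_sub))).

End ModPi.

Section Lattices.
Variables (V : vectType K) (rho : repn G V).
Implicit Type L : set V.

Definition is_lattice L :=
  exists e : 'I_(\dim {:V}) -> V,
    (forall a : 'I_(\dim {:V}) -> O,
       \sum_i val (a i) *: e i = 0 -> forall i, a i = 0) /\
    L = [set x | exists a : 'I_(\dim {:V}) -> O, x = \sum_i val (a i) *: e i].

Record stable_lattice := StableLattice {
  slat :> set V;
  slat_lattice : is_lattice slat;
  slat_stable : forall g, rho g @` slat = slat }.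

(* V seen as an O-module. *)
Definition res_type (w : dvaluation K) : Type := V.
HB.instance Definition _ := GRing.Zmodule.on (res_type v).
Definition res_scale (a : O) (x : res_type v) : res_type v := val a *: (x : V).

Lemma res_scaleA a b x : res_scale a (res_scale b x) = res_scale (a * b) x.
Proof. by rewrite /res_scale scalerA -rmorphM. Qed.
Lemma res_scale1 : left_id 1 res_scale.
Proof. by move=> x; rewrite /res_scale rmorph1 scale1r. Qed.
Lemma res_scaleDr : right_distributive res_scale +%R.
Proof. by move=> a x y; exact: scalerDr. Qed.
Lemma res_scaleDl x : {morph res_scale^~ x : a b / a + b}.
Proof. by move=> a b; rewrite /res_scale rmorphD scalerDl. Qed.
HB.instance Definition _ := GRing.Zmodule_isLmodule.Build O (res_type v)
  res_scaleA res_scale1 res_scaleDr res_scaleDl.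

Definition res_fun g (x : res_type v) : res_type v := rho g x.
Lemma res_fun_linear g : linear (res_fun g).
Proof. by move=> a x y; exact: (linearP (rho g)). Qed.
HB.instance Definition _ g := GRing.isLinear.Build O (res_type v) (res_type v) _
  (res_fun g) (res_fun_linear g).

Definition res_rep : rep O G :=
  Rep (@Repn _ _ (res_type v) (fun g => res_fun g) (act1 rho) (actM rho)).

Definition slat_sub (L : stable_lattice) : subrep res_rep.
Proof.
exists (L : set V).
- have [e [_ ->]] := slat_lattice L; exists (fun _ => 0).
  by rewrite big1 // => i _; rewrite rmorph0 scale0r.
- have [e [_ ->]] := slat_lattice L => _ _ [a ->] [b ->].
  exists (fun i => a i + b i); rewrite -big_split; apply: eq_bigr => i _.
  by rewrite rmorphD scalerDl.
- have [e [_ ->]] := slat_lattice L => c _ [a ->].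
  exists (fun i => c * a i); rewrite [LHS]scaler_sumr; apply: eq_bigr => i _.
  by rewrite rmorphM scalerA.
- by move=> g x Lx; rewrite -(slat_stable L g); exists x.
Defined.

Definition slat_rep (L : stable_lattice) : rep O G := srep (slat_sub L).

(* The representation L / pi L over the residue field. *)
Definition reduction (L : stable_lattice) : rep FF G := modpi_rep (slat_rep L).

Definition normalised_at (x : V) (L : stable_lattice) :=
  exists y : slat_rep L, val y = x /\ modpi y != 0.

Definition maximal_wrt (x : V) (L : stable_lattice) :=
  normalised_at x L /\
  forall L' : stable_lattice, normalised_at x L' -> L `<=` L' -> L' `<=` L.

Definition maximal_lattice (L : stable_lattice) :=
  exists x : V, x != 0 /\ maximal_wrt x L.

(* The semisimplification of L / pi L for some stable lattice L. It does not
   depend on L; the value when no stable lattice exists is irrelevant. *)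
Definition residual_ss : rep FF G :=
  match pselect (exists L : stable_lattice, True) with
  | left h => semisimplification (reduction (sval (cid h)))
  | right _ => dsum (fun i : void => match i with end)
  end.

Definition realises_nonsplit (Wi Wj : rep FF G) :=
  exists (L : stable_lattice) (U0 U1 : subrep (reduction L)),
    U0 `<=` U1 /\ nonsplit_extension Wi Wj (subquo U1 U0).

Section Graph.
Variables (r : nat) (W : 'I_r -> rep FF G).

Definition bellaiche_edge : rel 'I_r :=
  fun j i => `[< realises_nonsplit (W i) (W j) >].

(* Directed paths may repeat vertices. *)
Definition bellaiche_path (i j : 'I_r) (n : nat) :=
  exists p : seq 'I_r, [/\ path bellaiche_edge i p, last i p = j & size p = n].

End Graph.

End Lattices.

End Reduction.

Section Continuity.
Variables (K : fieldType) (v : dvaluation K) (G : topGroupType) (V : vectType K).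

(* Continuity for the valuation topology on matrices, in a basis of V. *)
Definition continuous_repn (rho : repn G V) :=
  continuous (fun g : G =>
    (\matrix_(i, j) (coord (vbasis {:V}) j (rho g (vbasis {:V})`_i) : valued v))
    : 'M[valued v]_(\dim {:V})).

End Continuity.

(* Main.v *)
Require Import Defs.
From HB Require Import structures.
From mathcomp Require Import all_boot all_order all_algebra.
From mathcomp Require Import boolp classical_sets topology.

Set Implicit Arguments.
Unset Strict Implicit.
Unset Printing Implicit Defensive.
Import Order.TTheory GRing.Theory Num.Theory.
Local Open Scope classical_set_scope.
Local Open Scope ring_scope.

(* Stable lattices, and more generally subquotients of reductions, are handled as
   O[G]-submodules of V. Such a submodule is a lattice as soon as it spans V and
   the valuations of the determinants of n-tuples of its vectors are bounded
   below: a tuple minimising this valuation is a basis. The same minimisation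
   gives the chain conditions between two lattices.

   Let W_i = A1 / A0 be a factor of some reduction and x in A1 but not in A0. By
   Zorn's lemma there is a maximal G-stable submodule M containing pi^-1 A0 with x
   not in pi M. If M were not a lattice then, K being complete, M would contain a
   line, and irreducibility of rho would give M = V. By maximality every nonzero
   subrepresentation of M / pi M contains the image of x, so the socle is simple
   and isomorphic to W_i.

   If W_j lies in level k + 2 of the socle filtration, take T minimal among the
   submodules mapping onto it: T meets the level below, and dividing by a maximal
   submodule of this intersection gives a non-split extension of W_j by a factor of
   level k + 1. Paths follow by induction. Every W_j occurs in every reduction, as
   one sees by intersecting with the multiples pi^t L, hence connectedness. *)

(** * Subquotients *)

Section Generic.
Variables (R : nzRingType) (G : groupType).

Lemma subrepN (M : rep R G) (A : subrep M) x : A x -> A (- x).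
Proof. by move=> Ax; rewrite -scaleN1r; exact: subrepZ. Qed.

Lemma subrepB (M : rep R G) (A : subrep M) x y : A x -> A y -> A (x - y).
Proof. by move=> Ax Ay; apply: subrepD => //; exact: subrepN. Qed.

Lemma subrep_sum (M : rep R G) (A : subrep M) (I : finType) (f : I -> M) :
  (forall i, A (f i)) -> A (\sum_i f i).
Proof.
move=> Af; elim/big_ind: _ => // [|x y]; [exact: subrep0|exact: subrepD].
Qed.

Definition capsub (M : rep R G) (A B : subrep M) : subrep M.
Proof.
exists [set x | A x /\ B x] => /=.
- by split; exact: subrep0.
- by move=> x y [? ?] [? ?]; split; exact: subrepD.
- by move=> a x [? ?]; split; exact: subrepZ.
- by move=> g x [? ?]; split; exact: subrepG.
Defined.

Definition addsub (M : rep R G) (A B : subrep M) : subrep M.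
Proof.
exists [set x | exists y z, [/\ A y, B z & x = y + z]] => /=.
- by exists 0, 0; split; [exact: subrep0|exact: subrep0|rewrite addr0].
- move=> _ _ [x [y [Ax By ->]]] [x' [y' [Ax' By' ->]]].
  by exists (x + x'), (y + y'); split; [exact: subrepD..|rewrite addrACA].
- move=> a _ [x [y [Ax By ->]]].
  by exists (a *: x), (a *: y); split; [exact: subrepZ..|rewrite scalerDr].
- move=> g _ [x [y [Ax By ->]]]; exists (rep_act M g x), (rep_act M g y).
  by split; [exact: subrepG..|rewrite linearD].
Defined.

Lemma capsubl (M : rep R G) (A B : subrep M) : capsub A B `<=` A.
Proof. by move=> x []. Qed.

Lemma capsubr (M : rep R G) (A B : subrep M) : capsub A B `<=` B.
Proof. by move=> x []. Qed.

Lemma addsubl (M : rep R G) (A B : subrep M) : A `<=` addsub A B.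
Proof. by move=> x Ax; exists x, 0; rewrite addr0; split=> //; exact: subrep0. Qed.

Lemma addsubr (M : rep R G) (A B : subrep M) : B `<=` addsub A B.
Proof. by move=> x Ax; exists 0, x; rewrite add0r; split=> //; exact: subrep0. Qed.

Lemma addsub_sub (M : rep R G) (A B C : subrep M) :
  A `<=` C -> B `<=` C -> addsub A B `<=` C.
Proof. by move=> sA sB _ [x [y [/sA Cx /sB Cy ->]]]; exact: subrepD. Qed.

Lemma not_subset (T : Type) (A B : set T) : ~ A `<=` B -> exists2 x, A x & ~ B x.
Proof.
move=> AB; apply: contrapT => h; apply: AB => x Ax; apply: contrapT => Bx.
by apply: h; exists x.
Qed.

Lemma idfun_surj (T : Type) (a : T) : exists b, idfun b = a.
Proof. by exists a. Qed.

(** Simplicity of [P / Q] stated through inclusions in [M], so that subquotients can be compared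
    without forming quotient modules. *)
Definition simpleq (M : rep R G) (P Q : subrep M) :=
  [/\ Q `<=` P, ~ P `<=` Q &
      forall B : subrep M, Q `<=` B -> B `<=` P -> B `<=` Q \/ P `<=` B].

Lemma linear_hom (M N : rep R G) (f : M -> N) :
  (forall x y, f (x + y) = f x + f y) -> (forall a x, f (a *: x) = a *: f x) ->
  exists h : {linear M -> N}, h =1 f.
Proof.
move=> fD fZ.
have flin : linear f by move=> a x y; rewrite fD fZ.
pose f0 : M -> N := f.
pose h : {linear M -> N} := HB.pack f0 (GRing.isLinear.Build R M N _ f0 flin).
by exists h.
Qed.

Lemma riso_intro (M N : rep R G) (f : M -> N) :
  (forall x y, f (x + y) = f x + f y) -> (forall a x, f (a *: x) = a *: f x) ->
  equivariant f -> (forall x, f x = 0 -> x = 0) -> (forall z, exists x, f x = z) ->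
  riso M N.
Proof.
move=> fD fZ fG finj fsurj; have [h hf] := linear_hom fD fZ.
have hinj : injective h.
  move=> x y xy; apply/eqP; rewrite -subr_eq0; apply/eqP/finj.
  by rewrite -hf linearB xy subrr.
exists h; split=> [g x|]; first by rewrite !hf fG.
have [g gP] := choice fsurj; exists g => x; last by rewrite hf gP.
by apply: hinj; rewrite [LHS]hf gP hf.
Qed.

Lemma riso_sym (M N : rep R G) : riso M N -> riso N M.
Proof.
move=> [f [fG [g fK gK]]]; apply: (@riso_intro _ _ g).
- by move=> x y; apply: (can_inj fK); rewrite linearD !gK.
- by move=> a x; apply: (can_inj fK); rewrite linearZ !gK.
- by move=> h x; apply: (can_inj fK); rewrite fG !gK.
- by move=> x gx0; rewrite -(gK x) gx0 linear0.
- by move=> x; exists (f x).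
Qed.

Lemma riso_trans (M N P : rep R G) : riso M N -> riso N P -> riso M P.
Proof.
move=> [f [fG fb]] [g [gG gb]]; apply: (@riso_intro _ _ (g \o f)).
- by move=> x y /=; rewrite !linearD.
- by move=> a x /=; rewrite !linearZ.
- by move=> h x /=; rewrite fG gG.
- move=> x /= h; apply: (bij_inj fb); apply: (bij_inj gb).
  by rewrite h !linear0.
- have [h hK Kh] := bij_comp gb fb.
  by move=> x; exists (h x); exact: Kh.
Qed.

(** Schur's lemma tested at one vector: since [f x] is nonzero, the kernel is not everything, hence
    zero, and the image is not zero, hence everything. *)
Lemma schur (X Y : rep R G) (f : {linear X -> Y}) (x : X) : irreducible X ->
  irreducible Y -> equivariant f -> f x <> 0 -> riso X Y.
Proof.
move=> [_ irrX] [_ irrY] fG fx.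
have kerP : exists U : subrep X, forall y, U y <-> f y = 0.
  unshelve eexists; first (exists [set y | f y = 0] => /=).
  - exact: linear0.
  - by move=> y z fy fz; rewrite linearD fy fz addr0.
  - by move=> a y fy; rewrite linearZ /= fy scaler0.
  - by move=> g y fy; rewrite fG fy linear0.
  by [].
have imP : exists U : subrep Y, forall y, U y <-> exists z, f z = y.
  unshelve eexists; first (exists [set y | exists z, f z = y] => /=).
  - by exists 0; exact: linear0.
  - by move=> _ _ [y <-] [z <-]; exists (y + z); rewrite linearD.
  - by move=> a _ [y <-]; exists (a *: y); rewrite linearZ.
  - by move=> g _ [y <-]; exists (rep_act X g y); rewrite fG.
  by [].
have [U UP] := kerP; have [I IP] := imP.
apply: (@riso_intro _ _ f) => // [y z|a y|y fy|z]; rewrite ?linearD ?linearZ //.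
- have [UE|UE] := irrX U; first by have := (UP y).2 fy; rewrite UE.
  by case: fx; apply/UP; rewrite UE.
- have [IE|IE] := irrY I; last by apply/IP; rewrite IE.
  by case: fx; have : I (f x) by [apply/IP; exists x]; rewrite IE.
Qed.

End Generic.

(** * Subquotients up to isomorphism, across a change of scalars *)

Section SubquoIso.
Variables (R F : nzRingType) (G : groupType) (s : R -> F).

(* [M] is a module over [R] and [X] over [F]: with [s] the reduction map this
   covers subquotients of V over the ring of integers, with [s = id] those of a
   representation over the residue field. *)
Definition subquo_iso (M : rep R G) (P Q : subrep M) (X : rep F G) :=
  exists f : M -> X,
  [/\ forall x y, P x -> P y -> f (x + y) = f x + f y,
      forall a x, P x -> f (a *: x) = s a *: f x,
      forall g x, P x -> f (rep_act M g x) = rep_act X g (f x),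
      forall z, exists2 x, P x & f x = z &
      forall x, P x -> (f x = 0 <-> Q x)].

Lemma subquo_iso_eqset (M : rep R G) (P P' Q Q' : subrep M) (X : rep F G) :
  P = P' :> set M -> Q = Q' :> set M -> subquo_iso P Q X -> subquo_iso P' Q' X.
Proof. by rewrite /subquo_iso => -> ->. Qed.

Lemma subquo_iso_eq (M : rep R G) (P Q : subrep M) (X : rep F G) f :
  (forall x y, P x -> P y -> f (x + y) = f x + f y) ->
  (forall x, P x -> (f x = 0 :> X <-> Q x)) ->
  forall x y, P x -> P y -> (f x = f y <-> Q (x - y)).
Proof.
move=> fD fQ x y Px Py.
have := fQ (x - y) (subrepB Px Py).
have -> : f (x - y) = f x - f y.
  by apply/eqP; rewrite eq_sym subr_eq -fD ?subrK //; exact: subrepB.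
by move=> <-; split=> [->|/eqP]; rewrite ?subrr // subr_eq0 => /eqP.
Qed.

(* Zassenhaus: both subquotients are that of [P] meet [P']. *)
Lemma subquo_iso_transfer (M : rep R G) (P Q P' Q' : subrep M) (X : rep F G) :
  (forall x, P x -> exists y, [/\ P y, P' y & Q (x - y)]) ->
  (forall x, P' x -> exists y, [/\ P y, P' y & Q' (x - y)]) ->
  (forall x, P x -> P' x -> (Q x <-> Q' x)) ->
  Q `<=` P -> Q' `<=` P' ->
  subquo_iso P' Q' X -> subquo_iso P Q X.
Proof.
move=> PP' P'P QQ' QP Q'P' [f [fD fZ fG fS fQ]].
have fE := subquo_iso_eq fD fQ.
(* [h x] will be a representative of [x] modulo [Q] lying in both [P] and [P']; outside [P] the
   value 0 is a mere default. *)
have hP x : exists y, P x -> [/\ P y, P' y & Q (x - y)].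
  by have [/PP'[y yP]|nP] := pselect (P x); [exists y|exists 0].
have [h {}hP] := choice hP.
(* The value of [f] does not depend on the representative, so each property of [f \o h] follows by
   exhibiting a convenient one. *)
have key x y : P x -> P y -> P' y -> Q (x - y) -> f (h x) = f y.
  move=> Px Py P'y Qxy; have [Phx P'hx Qx] := hP x Px.
  apply/fE => //; apply/QQ'; [exact: subrepB..|].
  rewrite -(subrKA x) addrC -[h x - x]opprB; exact: subrepB.
exists (f \o h); split=> /=.
- move=> x y Px Py; have [Phx P'hx Qx] := hP x Px; have [Phy P'hy Qy] := hP y Py.
  rewrite -fD //; apply: key; [exact: subrepD..|].
  by rewrite opprD addrACA; exact: subrepD.
- move=> a x Px; have [Phx P'hx Qx] := hP x Px.
  rewrite -fZ //; apply: key; [exact: subrepZ..|].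
  by rewrite -scalerBr; exact: subrepZ.
- move=> g x Px; have [Phx P'hx Qx] := hP x Px.
  rewrite -fG //; apply: key; [exact: subrepG..|].
  by rewrite -linearB; exact: subrepG.
- move=> z; have [x P'x <-] := fS z; have [y [Py P'y Qxy]] := P'P x P'x.
  exists y => //; rewrite (key y y) ?subrr //; last exact: subrep0.
  by apply/esym/fE.
- move=> x Px; have [Phx P'hx Qx] := hP x Px.
  rewrite fQ // -QQ' //; split=> Qh; last by rewrite -(subKr x (h x)); exact: subrepB.
  by rewrite -(subrK (h x) x); exact: subrepD.
Qed.

(** By simplicity [P] meet [P'] generates [P] modulo [Q] and [P'] modulo [Q']. The condition on [P]
    meet [Q'] yields its mirror image, that [P'] meet [Q] lies in [Q']. *)
Lemma subquo_iso_simple_transfer (M : rep R G) (P Q P' Q' : subrep M) (X : rep F G) :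
  simpleq P Q -> simpleq P' Q' -> ~ capsub P P' `<=` Q -> capsub P Q' `<=` Q ->
  subquo_iso P' Q' X -> subquo_iso P Q X.
Proof.
move=> [QP nPQ sP] [Q'P' nPQ' sP'] n1 i1.
have [x0 [Px0 P'x0] nQx0] := not_subset n1.
apply: subquo_iso_transfer => //.
- have [h|h x Px] := sP (addsub Q (capsub P P')) (@addsubl _ _ _ _ _)
    (addsub_sub QP (@capsubl _ _ _ _ _)).
    by case: n1 => x ?; apply: h; apply: addsubr.
  by have [y [z [Qy [Pz P'z] ->]]] := h x Px; exists z; rewrite addrK.
- have [h|h x Px] := sP' (addsub Q' (capsub P P')) (@addsubl _ _ _ _ _)
    (addsub_sub Q'P' (@capsubr _ _ _ _ _)).
    by case: nQx0; apply: i1; split=> //; apply: h; apply: addsubr.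
  by have [y [z [Qy [Pz P'z] ->]]] := h x Px; exists z; rewrite addrK.
- move=> x Px P'x; split=> [Qx|Q'x]; last exact: i1.
  have sub : addsub Q' (capsub P' Q) `<=` P' by apply: addsub_sub => // y [].
  (* Otherwise [P'] meet [Q] fills [P'] modulo [Q']; then [x0] is [y + z] with [z] in [Q] and [y] in
     [P] meet [Q'], which forces [x0] into [Q]. *)
  have [h|h] := sP' _ (@addsubl _ _ _ _ _) sub.
    by apply: h; apply: addsubr.
  have [y [z [Q'y [P'z Qz] x0E]]] := h x0 P'x0.
  case: nQx0; rewrite x0E; apply: subrepD => //; apply: i1; split=> //.
  by rewrite -(addrK z y) -x0E; apply: subrepB => //; apply: QP.
Qed.

(** Second isomorphism theorem: here [P] meet [C] is exactly [Q]. *)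
Lemma subquo_iso_add (M : rep R G) (P Q C : subrep M) (X : rep F G) : Q `<=` P ->
  Q `<=` C -> capsub P C `<=` Q -> subquo_iso P Q X -> subquo_iso (addsub C P) C X.
Proof.
move=> QP QC PCQ; apply: subquo_iso_transfer => //.
- move=> _ [y [z [Cy Pz ->]]]; exists z; rewrite addrK; split=> //.
  exact: addsubr.
- move=> x Px; exists x; rewrite subrr; split=> //; [exact: addsubr|exact: subrep0].
- by move=> x _ Px; split=> [Cx|/QC//]; apply: PCQ.
- exact: addsubl.
Qed.

Hypothesis s_surj : forall a, exists b, s b = a.

(** A submodule between [Q] and [P] has an image in [X]; surjectivity of [s] makes this image stable
    under the scalars of [F]. *)
Lemma subquo_iso_irr (M : rep R G) (P Q : subrep M) (X : rep F G) : Q `<=` P ->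
  subquo_iso P Q X -> irreducible X -> simpleq P Q.
Proof.
move=> QP [f [fD fZ fG fS fQ]] [[z z0] irrX]; split=> //.
  move=> PQ; have [x Px fx] := fS z.
  by move: z0; rewrite -fx ((fQ x Px).2 (PQ x Px)) eqxx.
move=> B QB BP.
have imP : exists U : subrep X, forall y, U y <-> exists2 z, B z & f z = y.
  unshelve eexists; first (exists [set y | exists2 z, B z & f z = y] => /=).
  - by exists 0; [exact: subrep0|apply/fQ; exact: subrep0].
  - move=> _ _ [y By <-] [t Bt <-]; exists (y + t); first exact: subrepD.
    by rewrite fD //; exact: BP.
  - move=> a _ [y By <-]; have [b <-] := s_surj a; exists (b *: y).
      exact: subrepZ.
    by rewrite fZ //; exact: BP.
  - move=> g _ [y By <-]; exists (rep_act M g y); first exact: subrepG.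
    by rewrite fG //; exact: BP.
  by [].
have [U UP] := imP.
have [UE|UE] := irrX U; [left|right] => x Bx.
  apply/fQ; first exact: BP.
  by have : U (f x) by [apply/UP; exists x]; rewrite UE.
have : U (f x) by rewrite UE.
move=> /UP[y By fxy].
have := (subquo_iso_eq fD fQ Bx (BP y By)).1 (esym fxy).
by move=> /QB h; rewrite -(subrK y x); exact: subrepD.
Qed.

Lemma subquo_iso_unique (M : rep R G) (P Q : subrep M) (X Y : rep F G) :
  subquo_iso P Q X -> subquo_iso P Q Y -> riso X Y.
Proof.
move=> [f [fD fZ fG fS fQ]] [h [hD hZ hG hS hQ]].
have fE := subquo_iso_eq fD fQ; have hE := subquo_iso_eq hD hQ.
have gP z : exists x, P x /\ f x = z by have [x Px <-] := fS z; exists x.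
have [g {}gP] := choice gP.
have key x z : P x -> f x = z -> h (g z) = h x.
  move=> Px fxz; have [Pgz fgz] := gP z.
  by apply/hE => //; apply/fE => //; rewrite fgz.
apply: (@riso_intro _ _ _ _ (h \o g)) => /=.
- move=> x y; have [Px fx] := gP x; have [Py fy] := gP y.
  rewrite (key (g x + g y)) ?hD //; first exact: subrepD.
  by rewrite fD // fx fy.
- move=> a x; have [Px fx] := gP x; have [b <-] := s_surj a.
  rewrite (key (b *: g x)) ?hZ //; first exact: subrepZ.
  by rewrite fZ // fx.
- move=> a x /=; have [Px fx] := gP x.
  rewrite (key (rep_act M a (g x))) ?hG //; first exact: subrepG.
  by rewrite fG // fx.
- by move=> x; have [Px fx] := gP x; rewrite hQ // -fQ // fx.
- by move=> y; have [x Px <-] := hS y; exists (f x); exact: key.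
Qed.

Lemma subquo_iso_riso (M : rep R G) (P Q : subrep M) (X Y : rep F G) :
  subquo_iso P Q X -> riso X Y -> subquo_iso P Q Y.
Proof.
move=> [f [fD fZ fG fS fQ]] [h [hG hb]]; exists (h \o f); split=> /=.
- by move=> x y Px Py; rewrite fD // linearD.
- by move=> a x Px; rewrite fZ // linearZ.
- by move=> g x Px; rewrite fG // hG.
- move=> z; have [h' _ hK] := hb; have [x Px fx] := fS (h' z).
  by exists x => //; rewrite fx hK.
- move=> x Px; rewrite -fQ //; split=> [h0|->]; last exact: linear0.
  by apply: (bij_inj hb); rewrite h0 linear0.
Qed.

Lemma simple_subquo_irr (M : rep R G) (P Q : subrep M) (X : rep F G) :
  subquo_iso P Q X -> simpleq P Q -> irreducible X.
Proof.
move=> [f [fD fZ fG fS fQ]] [QP nPQ sP]; split.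
  have [x Px nQx] := not_subset nPQ; exists (f x); apply/eqP => fx0.
  by apply: nQx; apply/fQ.
move=> U.
have preP : exists B : subrep M, forall x, B x <-> P x /\ U (f x).
  unshelve eexists; first (exists [set x | P x /\ U (f x)] => /=).
  - split; first exact: subrep0.
    by rewrite (fQ 0 (subrep0 P)).2; exact: subrep0.
  - move=> x y [Px Ux] [Py Uy]; split; first exact: subrepD.
    by rewrite fD //; exact: subrepD.
  - move=> a x [Px Ux]; split; first exact: subrepZ.
    by rewrite fZ //; exact: subrepZ.
  - move=> g x [Px Ux]; split; first exact: subrepG.
    by rewrite fG //; exact: subrepG.
  by [].
have [B BP] := preP.
have QB : Q `<=` B.
  move=> x Qx; apply/BP; split; first exact: QP.
  by rewrite (fQ x (QP x Qx)).2 //; exact: subrep0.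
have [h|h] := sP B QB (fun x h => ((BP x).1 h).1); [left|right]; apply/seteqP.
  split=> [z Uz|_ ->]; last exact: subrep0.
  have [x Px fx] := fS z; rewrite -fx /=; apply/fQ => //; apply: h; apply/BP.
  by rewrite fx.
by split=> // z _; have [x Px <-] := fS z; exact: ((BP x).1 (h x Px)).2.
Qed.

(* A simple subquotient detected by a semisimple layer [S1 / S0] occurs in it as
   a submodule: take [C] maximal not detecting it and add a simple [Z] to [C]. *)
Lemma semisimple_layer (M : rep R G) (S1 S0 P Q : subrep M) (X : rep F G) :
  S0 `<=` S1 ->
  (forall p : set (subrep M), (exists A, p A) ->
    (forall A, p A -> S0 `<=` A /\ A `<=` S1) ->
    exists2 A, p A & forall B, p B -> A `<=` B -> B `<=` A) ->
  (forall C : subrep M, S0 `<=` C ->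
     (forall Z, simpleq Z S0 -> Z `<=` S1 -> Z `<=` C) -> S1 `<=` C) ->
  (forall Z, simpleq Z S0 -> Z `<=` S1 -> exists X, subquo_iso Z S0 X) ->
  irreducible X -> subquo_iso P Q X -> Q `<=` P ->
  capsub P S0 `<=` Q -> ~ capsub P S1 `<=` Q ->
  exists Z, [/\ simpleq Z S0, Z `<=` S1 & subquo_iso Z S0 X].
Proof.
move=> S01 maxS genS exS irrX PQX QP PS0 PS1.
have simP := subquo_iso_irr QP PQX irrX.
have [||C [S0C [CS1 PC]] maxC] :=
  maxS [set C : subrep M | S0 `<=` C /\ C `<=` S1 /\ capsub P C `<=` Q].
- by exists S0; do 2!split=> //.
- by move=> A [? [? ?]].
(* If [C] contained every [Z] simple over [S0] inside [S1], it would contain [S1], which detects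
   [P / Q]. *)
have [Z [simZ ZS1 ZC]] : exists Z, [/\ simpleq Z S0, Z `<=` S1 & ~ Z `<=` C].
  apply: contrapT => nZ; have S1C : S1 `<=` C.
    apply: genS => // Z sZ ZS1; apply: contrapT => ZC.
    by apply: nZ; exists Z.
  by apply: PS1 => x [Px /S1C Cx]; apply: PC.
have [Y ZY] := exS Z simZ ZS1.
have [S0Z nZS0 sZ] := simZ.
have ZCS : capsub Z C `<=` S0.
  have [//||//|h] := sZ (capsub Z C).
  - by move=> x S0x; split; [exact: S0Z|exact: S0C].
  - by move=> x [].
  - by case: ZC => x /h[].
have irrY := simple_subquo_irr ZY simZ.
have CZY : subquo_iso (addsub C Z) C Y by exact: subquo_iso_add ZY.
have simCZ := subquo_iso_irr (@addsubl _ _ _ C Z) CZY irrY.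
(* By maximality of [C], [addsub C Z] detects [P / Q], so the two simple subquotients agree. *)
have PQY : subquo_iso P Q Y.
  apply: (subquo_iso_simple_transfer simP simCZ) CZY => //.
  move=> h; apply: ZC => x Zx; apply: (maxC (addsub C Z)).
  - split; first by move=> y /S0C; exact: addsubl.
    by split=> //; exact: addsub_sub.
  - exact: addsubl.
  - exact: addsubr.
have YX := subquo_iso_unique PQY PQX.
by exists Z; split=> //; exact: subquo_iso_riso ZY YX.
Qed.

End SubquoIso.

(** * Socle filtrations and extensions *)

Section ModuleTheory.
Variables (R : nzRingType) (G : groupType).
Implicit Types (M : rep R G).

Local Notation siso := (subquo_iso (@idfun R)).

(** A total retraction onto [srep P]: maps out of [P] become functions on all of [M], as
    [subquo_iso] requires. *)
Definition srep_proj M (P : subrep M) (x : M) : srep P := insubd (0 : srep_type P) x.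

Lemma srep_projK M (P : subrep M) x : P x -> val (srep_proj P x : srep_type P) = x.
Proof. by move=> Px; rewrite insubdK //; apply/asboolP. Qed.

Lemma srep_valP M (P : subrep M) (x : srep P) : P (val (x : srep_type P)).
Proof. by apply/asboolP; exact: (valP (x : srep_type P)). Qed.

Lemma srep_valK M (P : subrep M) (x : srep P) : srep_proj P (val (x : srep_type P)) = x.
Proof. exact: valKd. Qed.

Lemma srep_projD M (P : subrep M) x y : P x -> P y ->
  srep_proj P (x + y) = srep_proj P x + srep_proj P y.
Proof.
move=> Px Py; apply: (val_inj : injective (val : srep_type P -> M)).
by rewrite raddfD /= !srep_projK //; exact: subrepD.
Qed.

Lemma srep_projZ M (P : subrep M) a x : P x ->
  srep_proj P (a *: x) = a *: srep_proj P x.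
Proof.
move=> Px; apply: (val_inj : injective (val : srep_type P -> M)).
by rewrite linearZ /= !srep_projK //; exact: subrepZ.
Qed.

Lemma srep_projG M (P : subrep M) g x : P x ->
  srep_proj P (rep_act M g x) = rep_act (srep P) g (srep_proj P x).
Proof.
move=> Px; apply: (val_inj : injective (val : srep_type P -> M)).
by rewrite /= !srep_projK //; exact: subrepG.
Qed.

Lemma subquo_isoP M (P Q : subrep M) : siso P Q (subquo P Q).
Proof.
exists (fun x => qrep_pi (subrep_restr P Q) (srep_proj P x)); split.
- by move=> x y Px Py; rewrite srep_projD // raddfD.
- by move=> a x Px; rewrite srep_projZ // linearZ.
- by move=> g x Px; rewrite srep_projG // -qrep_funE.
- move=> z; exists (val (repr z : srep_type P)); first exact: srep_valP.
  by rewrite srep_valK qrep_pi_repr.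
- move=> x Px; rewrite -(raddf0 (qrep_pi (subrep_restr P Q))) qrep_piP subr0 /=.
  by rewrite srep_projK.
Qed.

Lemma qrep_iso M (S Z : subrep M) (U : subrep (qrep S)) :
  (forall x, Z x <-> U (qrep_pi S x)) -> siso Z S (srep U).
Proof.
move=> ZU; exists (fun x => srep_proj U (qrep_pi S x)); split.
- by move=> x y /ZU Ux /ZU Uy; rewrite raddfD; exact: srep_projD.
- by move=> a x /ZU Ux; rewrite linearZ; exact: srep_projZ.
- by move=> g x /ZU Ux; rewrite -qrep_funE; exact: srep_projG.
- move=> z; exists (repr (val (z : srep_type U))).
    by apply/ZU; rewrite qrep_pi_repr; exact: srep_valP.
  by rewrite qrep_pi_repr; exact: srep_valK.
- move=> x /ZU Ux.
  have -> : S x <-> qrep_pi S x = 0.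
    by rewrite -(raddf0 (qrep_pi S)) qrep_piP subr0.
  split=> [h|->].
    by rewrite -(srep_projK Ux) h raddf0.
  by apply: (val_inj : injective (val : srep_type U -> _)); rewrite srep_projK //; exact: subrep0.
Qed.

Lemma srep_iso M (P : subrep M) : siso P (subrep_zero M) (srep P).
Proof.
exists (srep_proj P); split.
- exact: srep_projD.
- exact: srep_projZ.
- exact: srep_projG.
- by move=> z; exists (val (z : srep_type P)); [exact: srep_valP|exact: srep_valK].
- move=> x Px; split=> [h|->]; first by rewrite /= -(srep_projK Px) h raddf0.
  apply: (val_inj : injective (val : srep_type P -> _)); rewrite srep_projK //.
  exact: subrep0.
Qed.

Lemma subrep_zeroP M (P : subrep M) : subrep_zero M `<=` P.
Proof. by move=> x ->; exact: subrep0. Qed.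

Lemma srep_irr M (P : subrep M) :
  irreducible (srep P) <-> simpleq P (subrep_zero M).
Proof.
split=> h; last exact: simple_subquo_irr (srep_iso P) h.
exact: (subquo_iso_irr (@idfun_surj R) (@subrep_zeroP _ P) (srep_iso P) h).
Qed.

Lemma subquo_irr M (P Q : subrep M) : simpleq P Q -> irreducible (subquo P Q).
Proof. exact: simple_subquo_irr (subquo_isoP P Q). Qed.

Lemma soc_simple M (Z : subrep M) : simpleq Z (subrep_zero M) -> Z `<=` soc M.
Proof.
move=> /srep_irr irrZ x Zx; exists 1%N, (fun _ => Z), (fun _ => x); split=> //.
by rewrite big_ord1.
Qed.

Lemma soc_gen M (C : subrep M) :
  (forall Z, simpleq Z (subrep_zero M) -> Z `<=` C) -> soc M `<=` C.
Proof.
move=> ZC _ [n [U [y [Uy ->]]]]; apply: subrep_sum => i.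
by have [/srep_irr simU Uyi] := Uy i; exact: ZC simU _ Uyi.
Qed.

Definition subrep_im M (S Z : subrep M) : subrep (qrep S).
Proof.
exists [set y | exists2 x, Z x & qrep_pi S x = y] => /=.
- by exists 0; [exact: subrep0|rewrite raddf0].
- by move=> _ _ [x Zx <-] [y Zy <-]; exists (x + y); rewrite ?raddfD //; exact: subrepD.
- by move=> a _ [x Zx <-]; exists (a *: x); rewrite ?linearZ //; exact: subrepZ.
- by move=> g _ [x Zx <-]; exists (rep_act M g x); [exact: subrepG|rewrite -qrep_funE].
Defined.

Lemma subrep_imP M (S Z : subrep M) x : S `<=` Z -> Z x <-> subrep_im S Z (qrep_pi S x).
Proof.
move=> SZ; split=> [Zx|[y Zy /qrep_piP yx]]; first by exists x.
by rewrite -(subKr y x); apply: subrepB => //; exact: SZ.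
Qed.

Lemma soc_filt_sub M k : soc_filt M k `<=` soc_filt M k.+1.
Proof.
move=> x Sx /=; rewrite (_ : qrep_pi _ x = 0); first exact: (subrep0 (soc _)).
by rewrite -(raddf0 (qrep_pi (soc_filt M k))); apply/qrep_piP; rewrite subr0.
Qed.

Lemma soc_filt_simple M k (Z : subrep M) :
  simpleq Z (soc_filt M k) -> Z `<=` soc_filt M k.+1.
Proof.
move=> simZ; have [SZ _ _] := simZ.
have iso := qrep_iso (fun x => subrep_imP x SZ).
have /srep_irr/soc_simple h := simple_subquo_irr iso simZ.
by move=> x Zx; apply: h; exists x.
Qed.

(** Together with [soc_filt_simple], this describes the next step of the filtration inside [M]
    itself, as the sum of the [Z] simple over the current step. *)
Lemma soc_filt_gen M k (C : subrep M) : soc_filt M k `<=` C ->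
  (forall Z, simpleq Z (soc_filt M k) -> Z `<=` soc_filt M k.+1 -> Z `<=` C) ->
  soc_filt M k.+1 `<=` C.
Proof.
move=> SC ZC x /= Sx; apply/(subrep_imP x SC); move: Sx.
apply: soc_gen => U /srep_irr irrU z Uz.
have iso : siso (subrep_pre U) (soc_filt M k) (srep U) by apply: qrep_iso.
have SU : soc_filt M k `<=` subrep_pre U.
  move=> y Sy /=; rewrite (_ : qrep_pi _ y = 0); first exact: (subrep0 U).
  by rewrite -(raddf0 (qrep_pi (soc_filt M k))); apply/qrep_piP; rewrite subr0.
have sim := subquo_iso_irr (@idfun_surj R) SU iso irrU.
exists (repr z); last exact: qrep_pi_repr.
by apply: (ZC _ sim); [exact: soc_filt_simple|rewrite /= qrep_pi_repr].
Qed.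

(** * Chain conditions and composition series *)

Definition noetherian M := forall p : set (subrep M), (exists A, p A) ->
  exists2 A, p A & forall B, p B -> A `<=` B -> B `<=` A.

Definition artinian M := forall p : set (subrep M), (exists A, p A) ->
  exists2 A, p A & forall B, p B -> B `<=` A -> A `<=` B.

Lemma simple_over M (A B : subrep M) : artinian M -> A `<=` B -> ~ B `<=` A ->
  exists2 Z, simpleq Z A & Z `<=` B.
Proof.
move=> art AB nBA.
have [|Z [AZ [ZB nZA]] minZ] :=
    art [set Z : subrep M | A `<=` Z /\ Z `<=` B /\ ~ Z `<=` A].
  by exists B; do 2!split=> //.
exists Z => //; split=> // C AC CZ; have [|nCA] := pselect (C `<=` A); first by left.
by right; apply: minZ => //; split=> //; split=> //; exact: subset_trans ZB.
Qed.

Lemma simple_under M (A B : subrep M) : noetherian M -> A `<=` B -> ~ B `<=` A ->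
  exists2 N, simpleq B N & A `<=` N.
Proof.
move=> noe AB nBA.
have [|N [AN [NB nBN]] maxN] :=
    noe [set N : subrep M | A `<=` N /\ N `<=` B /\ ~ B `<=` N].
  by exists A; do 2!split=> //.
exists N => //; split=> // C NC CB; have [|nBC] := pselect (B `<=` C); first by right.
by left; apply: maxN => //; split=> //; exact: subset_trans NC.
Qed.

Definition subrep_full M : subrep M.
Proof. by exists [set: M]. Defined.

(** A maximal member of the filtration must be everything, since a submodule simple over it would
    lie in the next step. *)
Lemma soc_filt_exhaustive M : noetherian M -> artinian M ->
  exists l, [set: M] `<=` soc_filt M l.
Proof.
move=> noe art.
have [|_ [l _ <-] maxl] := noe [set soc_filt M k | k in [set: nat]].
  by exists (soc_filt M 0), 0%N.
exists l; apply: contrapT => nl.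
have [Z simZ _] := @simple_over _ (soc_filt M l) (subrep_full M)
  art (fun _ _ => I) nl.
have [_ nZ _] := simZ; apply: nZ; apply: subset_trans (soc_filt_simple simZ) _.
by apply: maxl; [exists l.+1|exact: soc_filt_sub].
Qed.

Lemma simpleq_eq M (P P' Q Q' : subrep M) : P = P' :> set M -> Q = Q' :> set M ->
  simpleq P Q -> simpleq P' Q'.
Proof. by rewrite /simpleq => -> ->. Qed.

(** A minimal submodule without a series is nonzero, so it has a maximal proper submodule, whose
    series extends by one step. This guarantees that [semisimplification] of a reduction takes its
    intended value. *)
Lemma comp_series_exists M : noetherian M -> artinian M ->
  exists C : comp_series M, True.
Proof.
move=> noe art.
pose series (A : subrep M) := exists n (c : nat -> subrep M),
  [/\ c 0%N = [set 0] :> set M, c n = A :> set M &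
      forall k, (k < n)%N -> simpleq (c k.+1) (c k)].
have all_series A : series A.
  apply: contrapT => nA.
  have [|{nA}A nA minA] := art [set A | ~ series A]; first by exists A.
  apply: nA; have [A0|nA0] := pselect (A `<=` subrep_zero M).
    exists 0%N, (fun _ => A); split=> //.
    by apply/seteqP; split=> // x ->; exact: subrep0.
  have [N simN _] := simple_under noe (@subrep_zeroP _ A) nA0.
  have [NA nAN _] := simN.
  have [n [c [c0 cn simc]]] : series N.
    by apply: contrapT => nN; apply: nAN; exact: minA.
  exists n.+1, (fun k => if (k <= n)%N then c k else A); rewrite leq0n ltnn.
  split=> // k; rewrite ltnS => kn; rewrite kn.
  case: ltnP => [|nk]; first exact: simc.
  have kE : k = n by apply/eqP; rewrite eqn_leq kn nk.
  by apply: simpleq_eq simN => //; rewrite kE.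
have [n [c [c0 cn simc]]] := all_series (subrep_full M).
unshelve eexists => //; exists n c => // k /simc sim; last exact: subquo_irr.
by have [] := sim.
Qed.

(** Correspondence theorem; it trades the nested types in [occurs_in_level] for intermediate
    submodules of [M]. *)
Lemma subquo_subrepP M (S1 S0 : subrep M) (W : rep R G) : S0 `<=` S1 ->
  (exists U : subrep (subquo S1 S0), riso W (srep U)) <->
  exists Z : subrep M, [/\ S0 `<=` Z, Z `<=` S1 & siso Z S0 W].
Proof.
move=> S01; have [f [fD fZ fG fS fQ]] := subquo_isoP S1 S0.
split=> [[U iso]|[Z [S0Z ZS1 iso]]].
- have preP : exists Z : subrep M, forall x, Z x <-> S1 x /\ U (f x).
    unshelve eexists; first (exists [set x | S1 x /\ U (f x)] => /=).
    - split; first exact: subrep0.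
      by rewrite (fQ 0 (subrep0 S1)).2; exact: subrep0.
    - move=> x y [Px Ux] [Py Uy]; split; first exact: subrepD.
      by rewrite fD //; exact: subrepD.
    - move=> a x [Px Ux]; split; first exact: subrepZ.
      by rewrite fZ //; exact: subrepZ.
    - move=> g x [Px Ux]; split; first exact: subrepG.
      by rewrite fG //; exact: subrepG.
    by [].
  have [Z ZP] := preP; exists Z; split=> [x S0x|x /ZP[]//|].
    apply/ZP; split; first exact: S01.
    by rewrite (fQ x (S01 x S0x)).2 //; exact: subrep0.
  apply: subquo_iso_riso (riso_sym iso).
  have [h [hD hZ hG hS hQ]] := srep_iso U.
  exists (h \o f); split=> /=.
  - by move=> x y /ZP[Sx Ux] /ZP[Sy Uy]; rewrite fD // hD.
  - by move=> a x /ZP[Sx Ux]; rewrite fZ // hZ.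
  - by move=> a x /ZP[Sx Ux]; rewrite fG // hG.
  - move=> z; have [y Uy hy] := hS z; have [x Sx fx] := fS y.
    by exists x; [apply/ZP; rewrite fx|rewrite fx].
  - by move=> x /ZP[Sx Ux]; rewrite hQ // -fQ.
- have imP : exists U : subrep (subquo S1 S0), forall y, U y <-> exists2 x, Z x & f x = y.
    unshelve eexists; first (exists [set y | exists2 x, Z x & f x = y] => /=).
    - by exists 0; [exact: subrep0|apply/fQ; exact: subrep0].
    - move=> _ _ [y Zy <-] [t Zt <-]; exists (y + t); first exact: subrepD.
      by rewrite fD //; exact: ZS1.
    - move=> a _ [y Zy <-]; exists (a *: y); first exact: subrepZ.
      by rewrite fZ //; exact: ZS1.
    - move=> g _ [y Zy <-]; exists (rep_act M g y); first exact: subrepG.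
      by rewrite fG //; exact: ZS1.
    by [].
  have [U UP] := imP; exists U.
  apply: (subquo_iso_unique (@idfun_surj R) iso).
  have [h [hD hZ hG hS hQ]] := srep_iso U.
  have Uf x : Z x -> U (f x) by move=> Zx; apply/UP; exists x.
  exists (h \o f); split=> /=.
  - by move=> x y Zx Zy; rewrite fD ?hD; auto.
  - by move=> a x Zx; rewrite fZ ?hZ; auto.
  - by move=> a x Zx; rewrite fG ?hG; auto.
  - by move=> z; have [y /UP[x Zx <-] hy] := hS z; exists x.
  - by move=> x Zx; rewrite hQ -?fQ; auto.
Qed.

Lemma occurs_in_levelP (W : rep R G) M k : occurs_in_level W M k.+1 <->
  exists Z : subrep M,
    [/\ soc_filt M k `<=` Z, Z `<=` soc_filt M k.+1 & siso Z (soc_filt M k) W].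
Proof.
have := subquo_subrepP W (@soc_filt_sub M k).
by rewrite /occurs_in_level => <-; split=> [[]|].
Qed.

(* [T / N] is non-split as soon as nothing smaller than [T] complements [B]. *)
Lemma nonsplit_extension_intro M (N B T : subrep M) (X Y : rep R G) :
  N `<=` B -> B `<=` T -> ~ B `<=` N -> irreducible Y ->
  (forall T' : subrep M, N `<=` T' -> T' `<=` T -> ~ T' `<=` B -> T `<=` T') ->
  siso B N X -> siso T B Y -> nonsplit_extension Y X (subquo T N).
Proof.
move=> NB BT nBN [[y0 y00] _] minT [f [fD fZ fG fS fQ]] [h [hD hZ hG hS hQ]].
have fE := subquo_iso_eq fD fQ; have hE := subquo_iso_eq hD hQ.
have [q [qD qZ qG qS qQ]] := subquo_isoP T N.
have qE := subquo_iso_eq qD qQ.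
(* [b] and [t] choose lifts through [f] and [q]. The inclusion of the extension will be [q \o b] and
   its projection [h \o t], independent of the choices by [qb] and [ht]. *)
have bP x : exists b, B b /\ f b = x by have [b Bb <-] := fS x; exists b.
have [b {}bP] := choice bP.
have tP z : exists t, T t /\ q t = z by have [t Tt <-] := qS z; exists t.
have [t {}tP] := choice tP.
have qb x : B x -> q (b (f x)) = q x.
  move=> Bx; have [Bb fb] := bP (f x).
  by apply/qE; [exact: BT..|]; apply/fE.
have ht x : T x -> h (t (q x)) = h x.
  move=> Tx; have [Tt qt] := tP (q x).
  by apply/hE => //; apply: NB; apply/qE.
have [i iE] : exists i : {linear X -> subquo T N}, i =1 (q \o b).
  apply: linear_hom => [x y|a x] /=.
    have [Bx <-] := bP x; have [By <-] := bP y.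
    rewrite -fD // !qb //; last exact: subrepD.
    by rewrite qD //; exact: BT.
  have [Bx <-] := bP x; rewrite -fZ // !qb //; last exact: subrepZ.
  by rewrite qZ //; exact: BT.
have [p pE] : exists p : {linear subquo T N -> Y}, p =1 (h \o t).
  apply: linear_hom => [x y|a x] /=.
    have [Tx <-] := tP x; have [Ty <-] := tP y.
    by rewrite -qD // !ht // ?hD //; exact: subrepD.
  by have [Tx <-] := tP x; rewrite -qZ // !ht // ?hZ //; exact: subrepZ.
exists i, p; split; first split.
- move=> g x; rewrite !iE /=; have [Bx <-] := bP x; rewrite -fG // !qb //.
    by rewrite qG //; exact: BT.
  exact: subrepG.
- move=> g x; rewrite !pE /=; have [Tx <-] := tP x; rewrite -qG // !ht ?hG //.
  exact: subrepG.
- move=> x y; rewrite !iE /=; have [Bx <-] := bP x; have [By <-] := bP y.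
  by rewrite !qb // => /qE h'; apply/fE => //; apply: h'; exact: BT.
- move=> z; have [x Tx <-] := hS z; exists (q x); rewrite pE /=; exact: ht.
- move=> x; rewrite pE /=; have [Tx <-] := tP x; rewrite ht // hQ //.
  split=> [Bx|[y]]; first by exists (f (t x)); rewrite iE /= qb.
  rewrite iE /= => /qE; have [By _] := bP y => h'.
  rewrite -(subrK (b y) (t x)); apply: subrepD => //; apply: NB; apply: h' => //.
  exact: BT.
- move=> [r [rG rK]].
  (* [T'] is the preimage of the image of the section [r]. Minimality makes it equal to [T], so
     every class of [B / N] is in the image of [r] and killed by [p], hence zero. *)
  have preP : exists T' : subrep M, forall x, T' x <-> T x /\ exists y, q x = r y.
    unshelve eexists; first (exists [set x | T x /\ exists y, q x = r y] => /=).
    - split; first exact: subrep0.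
      by exists 0; rewrite linear0; apply/qQ; exact: subrep0.
    - move=> x y [Tx [x' qx]] [Ty [y' qy]]; split; first exact: subrepD.
      by exists (x' + y'); rewrite qD // qx qy linearD.
    - move=> a x [Tx [x' qx]]; split; first exact: subrepZ.
      by exists (a *: x'); rewrite qZ // qx linearZ.
    - move=> g x [Tx [x' qx]]; split; first exact: subrepG.
      by exists (rep_act Y g x'); rewrite qG // qx rG.
    by [].
  have [T' T'P] := preP.
  have TT' : T `<=` T'.
    apply: minT => [x Nx|x /T'P[]//|T'B].
      have Tx : T x by apply/BT/NB.
      by apply/T'P; split=> //; exists 0; rewrite linear0; apply/qQ.
    have [Tx qx] := tP (r y0).
    have /T'B/hQ : T' (t (r y0)) by apply/T'P; split=> //; exists y0.
    have := rK y0; rewrite pE /= => -> h'.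
    by move: y00; rewrite h' ?eqxx.
  apply: nBN => x Bx; have Tx := BT x Bx.
  have /T'P[_ [y qy]] := TT' x Tx.
  have y0' : y = 0 by rewrite -(rK y) -qy pE /= ht //; apply/hQ.
  by apply/qQ => //; rewrite qy y0' linear0.
Qed.

(* [T] is minimal among the submodules of [Z] not contained in the socle layer,
   so its top is [Y] and it has no proper supplement. *)
Lemma nonsplit_step M k (Z : subrep M) (Y : rep R G) : noetherian M -> artinian M ->
  irreducible Y -> soc_filt M k.+1 `<=` Z -> siso Z (soc_filt M k.+1) Y ->
  exists N B T : subrep M, [/\ N `<=` T, simpleq B N,
    (forall X, siso B N X -> nonsplit_extension Y X (subquo T N)) &
    forall X, irreducible X -> siso B N X -> occurs_in_level X M k.+1].
Proof.
move=> noe art irrY SZ iso; set S1 := soc_filt M k.+1 in SZ iso *.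
set S0 := soc_filt M k.
have S01 : S0 `<=` S1 by exact: soc_filt_sub.
have simZ := subquo_iso_irr (@idfun_surj R) SZ iso irrY; have [_ nZS sZ] := simZ.
have [|T [S0T [TZ nTS]] minT] :=
    art [set T : subrep M | S0 `<=` T /\ T `<=` Z /\ ~ T `<=` S1].
  by exists Z; split; [exact: (subset_trans S01 SZ)|split=> //].
(* Simplicity of [Z / S1] gives [Z = S1 + T]. *)
have TBY : siso T (capsub T S1) Y.
  apply: (subquo_iso_transfer _ _ _ (@capsubl _ _ _ T S1) SZ) iso.
  - move=> x Tx; exists x; rewrite subrr; split=> //; first exact: TZ.
    exact: subrep0.
  - have [h|h x /h[y [z [Sy Tz ->]]]] := sZ _ (@addsubl _ _ _ S1 T) (addsub_sub SZ TZ).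
      by case: nTS; apply: subset_trans h; exact: addsubr.
    by exists z; rewrite addrK; split=> //; exact: TZ.
  - by move=> x Tx _; split=> [[]|].
set B := capsub T S1 in TBY.
have S0B : S0 `<=` B by move=> x S0x; split; [exact: S0T|exact: S01].
(* Otherwise [T] would be simple over [S0], and so contained in [S1]. *)
have nBS0 : ~ B `<=` S0.
  move=> BS0; apply: nTS; apply: soc_filt_simple.
  have := subquo_iso_irr (@idfun_surj R) (@capsubl _ _ _ T S1) TBY irrY.
  by apply: simpleq_eq => //; apply/seteqP.
have [N simN S0N] := simple_under noe S0B nBS0; have [NB nBN _] := simN.
exists N, B, T; split=> //.
- by apply: subset_trans NB _; exact: capsubl.
- move=> X isoX; apply: (nonsplit_extension_intro NB) isoX TBY => //.
    exact: capsubl.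
  move=> T' NT' T'T nT'B; apply: minT => //; split; first exact: subset_trans NT'.
  split; first exact: subset_trans TZ.
  by move=> T'S1; apply: nT'B => x T'x; split; [exact: T'T|exact: T'S1].
- move=> X irrX isoX; apply/occurs_in_levelP.
  (* [B] lies in [S1] and [N] contains [S0], so the layer [S1 / S0] detects [B / N]. *)
  have [|||||Z' [[S0Z' _ _] Z'S1 isoZ']] := semisimple_layer (@idfun_surj R) S01 _ _ _ irrX isoX NB.
  + by move=> p pA _; exact: noe.
  + exact: soc_filt_gen.
  + by move=> Z' _ _; exists (subquo Z' S0); exact: subquo_isoP.
  + by move=> x [Bx S0x]; exact: S0N.
  + by move=> h; apply: nBN => x Bx; apply: h; split=> //; case: Bx.
  by exists Z'.
Qed.

End ModuleTheory.

(** * Direct sums *)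

Section DirectSums.
Variables (R : nzRingType) (G : groupType).

Lemma dsumDE (I : finType) (N : I -> rep R G) (x y : dsum N) i :
  (x + y) i = x i + y i.
Proof. by []. Qed.

Lemma dsumZE (I : finType) (N : I -> rep R G) a (x : dsum N) i :
  (a *: x) i = a *: x i.
Proof. by []. Qed.

Definition dsum_incl (I : finType) (N : I -> rep R G) i (x : N i) : dsum N :=
  dfwith (fun j => 0 : N j) x.

Lemma dsum_incl_hom (I : finType) (N : I -> rep R G) i :
  [/\ forall x y : N i, dsum_incl (x + y) = dsum_incl x + dsum_incl y,
      forall a (x : N i), dsum_incl (a *: x) = a *: dsum_incl x,
      equivariant (@dsum_incl I N i) &
      forall x : N i, dsum_incl x i = x].
Proof.
rewrite /dsum_incl; split=> [x y|a x|g x|x]; last exact: dfwith_in.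
- apply: functional_extensionality_dep => j.
  rewrite dsumDE; have [<-|ij] := eqVneq i j; first by rewrite !dfwith_in.
  by rewrite !dfwith_out // addr0.
- apply: functional_extensionality_dep => j.
  rewrite dsumZE; have [<-|ij] := eqVneq i j; first by rewrite !dfwith_in.
  by rewrite !dfwith_out // scaler0.
- apply: functional_extensionality_dep => j.
  rewrite /= /dsum_fun; have [<-|ij] := eqVneq i j; first by rewrite !dfwith_in.
  by rewrite !dfwith_out // linear0.
Qed.

Lemma schur_comp (X Y : rep R G) (f : X -> Y) x : irreducible X -> irreducible Y ->
  (forall x y, f (x + y) = f x + f y) -> (forall a x, f (a *: x) = a *: f x) ->
  equivariant f -> f x <> 0 -> riso X Y.
Proof.
move=> irrX irrY fD fZ fG fx; have [h hE] := linear_hom fD fZ.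
by apply: (@schur _ _ _ _ h x) => // [g y|]; rewrite !hE.
Qed.

Lemma dsum_neq0 (I : finType) (N : I -> rep R G) (x : dsum N) :
  x <> 0 -> exists i, x i <> 0.
Proof.
move=> x0; apply: contrapT => h; apply: x0; apply: functional_extensionality_dep => i.
by apply: contrapT => xi; apply: h; exists i.
Qed.

(** Restricted to one summand the isomorphism is injective, so some component is nonzero and Schur's
    lemma applies. This compares the isomorphism classes that occur, without multiplicities. *)
Lemma dsum_constituents (I J : finType) (N : I -> rep R G) (W : J -> rep R G)
    (m : J -> nat) : (forall i, irreducible (N i)) -> (forall j, irreducible (W j)) ->
  (forall j, (1 <= m j)%N) -> riso (dsum N) (dsum (fun j => rpow (W j) (m j))) ->
  (forall i, exists j, riso (N i) (W j)) /\ (forall j, exists i, riso (W j) (N i)).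
Proof.
move=> irrN irrW m1 iso; split=> [i|j].
- have [f [fG fb]] := iso; have [iD iZ iG iK] := dsum_incl_hom N i.
  have [[x /eqP x0] _] := irrN i.
  have : f (dsum_incl x) <> 0.
    move=> fx; have := bij_inj fb (etrans fx (esym (linear0 f))).
    by move=> ix; apply: x0; rewrite -(iK x) ix.
  move=> /dsum_neq0[j] /(@dsum_neq0 _ (fun=> W j))[t fx]; exists j.
  apply: (@schur_comp _ _ (fun x => f (dsum_incl x) j t) x) => //.
  + by move=> y z; rewrite iD linearD.
  + by move=> a y; rewrite iZ linearZ.
  + by move=> g y; rewrite iG fG.
(* [m j] being positive, [t] is the index of the first copy of [W j]. *)
- have [f [fG fb]] := riso_sym iso; pose t := Ordinal (m1 j).
  have [iD iZ iG iK] := dsum_incl_hom (fun j => rpow (W j) (m j)) j.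
  have [kD kZ kG kK] := dsum_incl_hom (fun _ : 'I_(m j) => W j) t.
  have [[x /eqP x0] _] := irrW j.
  pose h (x : W j) := @dsum_incl _ (fun j => rpow (W j) (m j)) j
    (@dsum_incl _ (fun _ : 'I_(m j) => W j) t x).
  have : f (h x) <> 0.
    move=> fx; have := bij_inj fb (etrans fx (esym (linear0 f))).
    by move=> ix; apply: x0; rewrite -(kK x) -(iK (dsum_incl _)) -/(h x) ix.
  move=> /dsum_neq0[i fx]; exists i.
  apply: (@schur_comp _ _ (fun x => f (h x) i) x) => //; rewrite /h.
  + by move=> y z; rewrite kD iD linearD.
  + by move=> a y; rewrite kZ iZ linearZ.
  + by move=> g y; rewrite kG iG fG.
Qed.

End DirectSums.

(** * Lattices and determinants *)

Section LatticeTheory.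
Variables (K : fieldType) (v : dvaluation K) (pi : uniformizer v).
Variables (G : groupType) (V : vectType K) (rho : repn G V).
Local Notation O := (OK v).
Local Notation n := (\dim {:V}).
Local Notation VO := (res_rep v rho).
Local Notation lat A := (is_lattice v ((A : subrep VO) : set V)).

Lemma pi_neq0 : (pi : K) != 0. Proof. exact: unif_neq0. Qed.

Lemma dvalX k : v (unif pi ^+ k) = k%:Z.
Proof.
elim: k => [|k IH]; first by rewrite expr0 dval1.
by rewrite exprS dvalM ?expf_neq0 ?pi_neq0 // unif_val IH -intS.
Qed.

Lemma dvalV x : x != 0 -> v x^-1 = - v x.
Proof.
move=> x0; apply/eqP; rewrite -subr_eq0 opprK addrC -dvalM ?invr_neq0 //.
by rewrite divff // dval1.
Qed.

Lemma val_ge_int (c : K) : val_ge v 0 c -> exists a : O, val a = c.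
Proof. by move=> c0; exists (Sub c c0). Qed.

Lemma int_val_ge (a : O) : val_ge v 0 (val a).
Proof. exact: (valP a). Qed.

(** A common denominator: the sum of the absolute values of the valuations dominates each of
    them. *)
Lemma pi_pow_int (I : finType) (c : I -> K) :
  exists N, forall k i, (N <= k)%N -> val_ge v 0 (unif pi ^+ k * c i).
Proof.
exists (\sum_i `|v (c i)|)%N => k i Nk; rewrite /val_ge.
have [->|ci0] := eqVneq (c i) 0; first by rewrite mulr0 eqxx.
rewrite dvalM ?expf_neq0 ?pi_neq0 // dvalX; apply/orP; right.
have ik : (`|v (c i)| <= k)%N by apply: leq_trans Nk; rewrite (bigD1 i) //= leq_addr.
rewrite -(subrr `|v (c i)|) -abszE; apply: lerD; first by rewrite lez_nat.
by rewrite lerNl abszE -normrN ler_norm.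
Qed.

Lemma absz_split (a b : int) : b <= a -> a = b + `|a - b|%N%:Z.
Proof. by move=> ba; rewrite gez0_abs ?subr_ge0 // addrCA subrr addr0. Qed.

(** * Coordinates in a fixed basis of [V] and determinants of tuples *)

Definition crd (x : V) : 'rV[K]_n := \row_j coord (vbasis {:V}) j x.

Lemma crdK x : x = \sum_j crd x 0 j *: (vbasis {:V})`_j.
Proof.
rewrite {1}(coord_vbasis (memvf x)).
by apply: eq_bigr => j _; rewrite mxE.
Qed.

Lemma crd_inj : injective crd.
Proof. by move=> x y xy; rewrite (crdK x) xy -crdK. Qed.

Lemma crd_sum (I : finType) (c : I -> K) (e : I -> V) :
  crd (\sum_i c i *: e i) = \sum_i c i *: crd (e i).
Proof.
apply/rowP => j; rewrite mxE linear_sum summxE; apply: eq_bigr => i _.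
by rewrite linearZ !mxE.
Qed.

Definition crdmx (e : 'I_n -> V) : 'M[K]_n := \matrix_i crd (e i).
(** The valuation of [Delta e] measures how small the lattice spanned by [e] is. *)
Definition Delta (e : 'I_n -> V) : K := \det (crdmx e).

Lemma crdmx_mul (c : 'rV[K]_n) (e : 'I_n -> V) :
  c *m crdmx e = crd (\sum_i c 0 i *: e i).
Proof. by rewrite crd_sum mulmx_sum_row; apply: eq_bigr => i _; rewrite rowK. Qed.

(** Cramer's rule: the modified determinant is expanded along row [i], where its cofactors are those
    of [crdmx e]. *)
Lemma Delta_expand (e : 'I_n -> V) (x : V) : Delta e != 0 ->
  exists2 c : 'I_n -> K, x = \sum_i c i *: e i &
    forall i, c i * Delta e = Delta (fun j => if j == i then x else e j).
Proof.
move=> De; pose c := crd x *m invmx (crdmx e).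
exists (fun i => c 0 i).
  apply: crd_inj; rewrite -crdmx_mul /c mulmxKV // unitmxE unitfE.
  exact: De.
move=> i.
have -> : c 0 i * Delta e = \sum_j crd x 0 j * cofactor (crdmx e) i j.
  rewrite /c /invmx unitmxE unitfE [_ != 0]De -scalemxAr mxE mulrC mulrA.
  rewrite mulfV // mul1r mxE; apply: eq_bigr => j _; by rewrite !mxE.
rewrite /Delta (expand_det_row _ i); apply: eq_bigr => j _.
congr (_ * _); first by rewrite [RHS]mxE eqxx.
rewrite /cofactor; congr (_ * \det _); apply/matrixP => k l; rewrite !mxE.
by rewrite eq_sym (negPf (neq_lift _ _)).
Qed.

Definition span (e : 'I_n -> V) : set V :=
  [set x | exists a : 'I_n -> O, x = \sum_i val (a i) *: e i].

Lemma span_id e i : span e (e i).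
Proof.
exists (fun j => (j == i)%:R); rewrite (bigD1 i) //= big1 => [|j ji].
  by rewrite eqxx rmorph1 scale1r addr0.
by rewrite (negPf ji) rmorph0 scale0r.
Qed.

Lemma span_sub e (A : subrep VO) : (forall i, A (e i)) -> span e `<=` A.
Proof.
move=> Ae _ [a ->]; apply: (@subrep_sum _ _ VO A _ (fun i => a i *: (e i : VO))) => i.
exact: subrepZ.
Qed.

(** The matrix expressing [e'] through [e] is integral, hence so is its determinant. *)
Lemma Delta_span e e' : Delta e != 0 -> (forall i, span e (e' i)) ->
  val_ge v (v (Delta e)) (Delta e').
Proof.
move=> De /choice[a ea].
have -> : Delta e' = \det (map_mx val (\matrix_(i, j) a i j)) * Delta e.
  rewrite -det_mulmx; congr (\det _); apply/row_matrixP => i.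
  rewrite rowK row_mul crdmx_mul {1}ea; congr crd; apply: eq_bigr => j _.
  by rewrite !mxE.
rewrite det_map_mx -[v _]add0r; apply: val_geM; first exact: int_val_ge.
by rewrite /val_ge lexx orbT.
Qed.

(* By Cramer's rule the coordinates are quotients of determinants. *)
Lemma span_min (A : subrep VO) e : (forall i, A (e i)) -> Delta e != 0 ->
  (forall e', (forall i, A (e' i)) -> val_ge v (v (Delta e)) (Delta e')) ->
  (A : set V) = span e.
Proof.
move=> Ae De minA; apply/seteqP; split; last exact: span_sub.
move=> x Ax; have [c xE cE] := Delta_expand x De.
have ci i : exists a : O, val a = c i.
  apply: val_ge_int; have : val_ge v (v (Delta e)) (c i * Delta e).
    by rewrite cE; apply: minA => j; case: ifP.
  rewrite /val_ge mulf_eq0 (negPf De) orbF.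
  have [//|c0] := eqVneq (c i) 0; rewrite dvalM //.
  by rewrite -lerBlDr subrr.
have [a aE] := choice ci; exists a; rewrite xE.
by apply: eq_bigr => i _; rewrite aE.
Qed.

(** A linear relation over [K] becomes integral after clearing denominators, so freeness over the
    ring of integers gives independence over [K]. *)
Lemma lattice_basis (L : set V) : is_lattice v L ->
  exists2 e, Delta e != 0 & L = span e.
Proof.
move=> [e [free ->]]; exists e => //; apply/det0P => -[c c0 ce].
have ce0 : \sum_i c 0 i *: e i = 0.
  by apply: crd_inj; rewrite -crdmx_mul ce; apply/rowP => j; rewrite !mxE linear0.
have [N Nc] := pi_pow_int (fun i => c 0 i).
have /choice[a aE] : forall i, exists a : O, val a = unif pi ^+ N * c 0 i.
  by move=> i; apply: val_ge_int; exact: Nc.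
case/negP: c0; apply/eqP/rowP => i; rewrite mxE; apply/eqP.
have : val (a i) = 0.
  rewrite (free a) ?rmorph0 //.
  rewrite -[RHS](scaler0 _ (unif pi ^+ N)) -[in RHS]ce0 scaler_sumr.
  apply: eq_bigr => j _.
  by rewrite aE scalerA.
by move/eqP; rewrite aE mulf_eq0 (negPf (expf_neq0 _ pi_neq0)).
Qed.

Lemma span_lattice e : Delta e != 0 -> is_lattice v (span e).
Proof.
move=> De; exists e; split=> // a ae0 i; apply: val_inj; rewrite rmorph0.
have : (\row_i val (a i)) *m crdmx e = 0.
  rewrite crdmx_mul (_ : \sum_i _ = 0).
    by apply/rowP => j; rewrite !mxE linear0.
  by rewrite -[RHS]ae0; apply: eq_bigr => j _; rewrite mxE.
move/(canRL (mulmxK _)); rewrite unitmxE unitfE => /(_ De).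
by rewrite mul0mx => /rowP/(_ i); rewrite !mxE.
Qed.

Lemma lattice_intro (A : subrep VO) e b : (forall i, A (e i)) -> Delta e != 0 ->
  (forall e', (forall i, A (e' i)) -> val_ge v b (Delta e')) -> lat A.
Proof.
move=> Ae De bA.
(* Valuations bounded below by [b] are recorded as natural numbers [m], so that a least one
   exists. *)
pose p m := `[< exists e, [/\ forall i, A (e i), Delta e != 0 & v (Delta e) = b + m%:Z] >].
have pP e' : (forall i, A (e' i)) -> Delta e' != 0 -> exists2 m, p m & v (Delta e') = b + m%:Z.
  move=> Ae' De'; have := bA e' Ae'; rewrite /val_ge (negPf De') /= => be.
  exists `|v (Delta e') - b|%N; last exact: absz_split.
  by apply/asboolP; exists e'; split=> //; exact: absz_split.
have exp : exists m, p m by have [m pm _] := pP e Ae De; exists m.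
case: (ex_minnP exp) => m /asboolP[e0 [Ae0 De0 vDe0]] minm.
rewrite (span_min Ae0 De0); first exact: span_lattice.
move=> e' Ae'; rewrite /val_ge; have [//|De'] /= := eqVneq (Delta e') 0.
have [m' pm' ->] := pP e' Ae' De'.
by rewrite vDe0 lerD2l lez_nat; exact: minm.
Qed.

Lemma lattice_sandwich (A B C : subrep VO) : lat A -> lat B -> A `<=` C ->
  C `<=` B -> lat C.
Proof.
move=> /lattice_basis[e De AE] /lattice_basis[f Df BE] AC CB.
apply: (@lattice_intro _ e (v (Delta f))) => // [i|e' Ce'].
  by apply: AC; rewrite AE; exact: span_id.
by apply: Delta_span => // i; rewrite -BE; exact: CB.
Qed.

(** Choose a member and a tuple in it with [Delta] of least valuation. A larger member contains the
    same tuple, which is still minimal there and so spans it by [span_min]. *)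
Lemma lattice_max (A0 B0 : subrep VO) (p : set (subrep VO)) : lat A0 -> lat B0 ->
  (exists A, p A) -> (forall A, p A -> A0 `<=` A /\ A `<=` B0) ->
  exists2 A, p A & forall B, p B -> A `<=` B -> B `<=` A.
Proof.
move=> /lattice_basis[e De AE] /lattice_basis[f Df BE] [A pA] sand.
pose q m := `[< exists A e, [/\ p A, forall i, A (e i), Delta e != 0 &
  v (Delta e) = v (Delta f) + m%:Z] >].
have qP B g : p B -> (forall i, B (g i)) -> Delta g != 0 ->
    exists2 m, q m & v (Delta g) = v (Delta f) + m%:Z.
  move=> pB Bg Dg.
  have : val_ge v (v (Delta f)) (Delta g).
    by apply: Delta_span => // i; rewrite -BE; apply: (sand B pB).2.
  rewrite /val_ge (negPf Dg) /= => fg.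
  exists `|v (Delta g) - v (Delta f)|%N.
    by apply/asboolP; exists B, g; split=> //; exact: absz_split.
  exact: absz_split.
have exq : exists m, q m.
  have [|m qm _] := qP A e pA _ De; last by exists m.
  by move=> i; apply: (sand A pA).1; rewrite AE; exact: span_id.
case: (ex_minnP exq) => m /asboolP[C [g [pC Cg Dg vDg]]] minm.
exists C => // B pB CB; rewrite (@span_min B g) //; first exact: span_sub.
  by move=> i; apply: CB.
move=> e' Be'; rewrite /val_ge; have [//|De'] /= := eqVneq (Delta e') 0.
have [m' qm' ->] := qP B e' pB Be' De'.
by rewrite vDg lerD2l lez_nat; exact: minm.
Qed.

(** Choose the member whose basis has [Delta] of largest valuation, a quantity bounded above through
    [A0]. A basis of a smaller member then has the same valuation and spans the chosen one. *)
Lemma lattice_min (A0 B0 : subrep VO) (p : set (subrep VO)) : lat A0 -> lat B0 ->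
  (exists A, p A) -> (forall A, p A -> A0 `<=` A /\ A `<=` B0) ->
  exists2 A, p A & forall B, p B -> B `<=` A -> A `<=` B.
Proof.
move=> latA latB [A pA] sand; have [e De AE] := lattice_basis latA.
have platP B : p B -> exists2 g, Delta g != 0 & (B : set V) = span g.
  by move=> /sand[AB BB]; apply/lattice_basis/(lattice_sandwich latA latB).
pose q m := `[< exists A g, [/\ p A, (A : set V) = span g, Delta g != 0 &
  v (Delta e) = v (Delta g) + m%:Z] >].
have qP B g : p B -> (B : set V) = span g -> Delta g != 0 ->
    exists2 m, q m & v (Delta e) = v (Delta g) + m%:Z.
  move=> pB Bg Dg.
  have : val_ge v (v (Delta g)) (Delta e).
    apply: Delta_span => // i; rewrite -Bg; apply: (sand B pB).1.
    by rewrite AE; exact: span_id.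
  rewrite /val_ge (negPf De) /= => fg.
  exists `|v (Delta e) - v (Delta g)|%N.
    by apply/asboolP; exists B, g; split=> //; exact: absz_split.
  exact: absz_split.
have exq : exists m, q m.
  by have [g Dg Ag] := platP A pA; have [m qm _] := qP A g pA Ag Dg; exists m.
case: (ex_minnP exq) => m /asboolP[C [g [pC Cg Dg vDg]]] minm.
exists C => // B pB BC; have [h Dh Bh] := platP B pB.
have Bhi i : B (h i) by rewrite Bh; exact: span_id.
rewrite (@span_min C h) //; [exact: span_sub|by move=> i; exact: BC|].
have [m' qm' vDe] := qP B h pB Bh Dh; move=> e' Ce'.
apply: (@val_ge_le _ _ _ (v (Delta g))); last first.
  by apply: Delta_span => // i; rewrite -Cg.
by rewrite -(lerD2r m'%:Z) -vDe vDg lerD2l lez_nat; exact: minm.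
Qed.

(** For nonzero [c] this is the multiple [c A], encoded as a preimage under division by [c] so that
    membership unfolds without an existential. *)
Definition scalesub (c : K) (A : subrep VO) : subrep VO.
Proof.
exists [set x : V | A (c^-1 *: x)] => /=.
- by rewrite scaler0; exact: (subrep0 A).
- by move=> x y Ax Ay; rewrite scalerDr; exact: (subrepD Ax Ay).
- move=> a x Ax; rewrite [a *: x]/(val a *: (x : V)) scalerA mulrC -scalerA.
  exact: (subrepZ a Ax).
- by move=> g x /(subrepG g); rewrite /= /res_fun linearZ.
Defined.

Lemma scalesub_lat c A : c != 0 -> lat A -> lat (scalesub c A).
Proof.
move=> c0 [e [free AE]]; exists (fun i => c *: e i); split=> [a ae|].
  apply: free; apply: (scalerI c0); rewrite scaler0 -[RHS]ae scaler_sumr.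
  by apply: eq_bigr => i _; rewrite !scalerA mulrC.
rewrite /= AE; apply/seteqP; split=> x /= [a xE]; exists a.
  rewrite -(scalerK (invr_neq0 c0) x) invrK xE scaler_sumr.
  by apply: eq_bigr => i _; rewrite !scalerA mulrC.
rewrite xE scaler_sumr; apply: eq_bigr => i _; rewrite !scalerA mulrCA mulVf //.
by rewrite mulr1.
Qed.

Lemma scalesub_iso (F : nzRingType) (s : O -> F) c (P Q : subrep VO) (X : rep F G) :
  c != 0 -> subquo_iso s P Q X -> subquo_iso s (scalesub c P) (scalesub c Q) X.
Proof.
move=> c0 [f [fD fZ fG fS fQ]]; exists (fun x : V => f (c^-1 *: x)); split.
- by move=> x y Px Py; rewrite scalerDr fD.
- move=> a x Px; rewrite [a *: x]/(val a *: (x : V)) scalerA mulrC -scalerA.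
  exact: (fZ a).
- by move=> g x Px; rewrite -fG //= /res_fun linearZ.
- move=> z; have [x Px <-] := fS z; exists (c *: (x : V)).
    by rewrite /= scalerA mulVf // scale1r.
  by rewrite scalerA mulVf // scale1r.
- by move=> x Px; rewrite fQ.
Qed.

Lemma subrep_int (A : subrep VO) (c : K) (x : V) : val_ge v 0 c -> A x -> A (c *: x).
Proof. by move=> /val_ge_int[a <-] Ax; exact: (subrepZ a Ax). Qed.

Lemma pi_int k : val_ge v 0 (unif pi ^+ k).
Proof. by rewrite /val_ge dvalX orbT. Qed.

(** Commensurability of lattices: clear the denominators of the coordinates of a basis of [B] in a
    basis of [A]. *)
Lemma lattice_absorb (A B : subrep VO) : lat A -> lat B ->
  exists N, forall x, B x -> A (unif pi ^+ N *: (x : V)).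
Proof.
move=> /lattice_basis[e De AE] /lattice_basis[f Df BE].
have /choice[c cE] i : exists c : 'I_n -> K, f i = \sum_j c j *: e j.
  by have [c cE _] := Delta_expand (f i) De; exists c.
have [N Nc] := pi_pow_int (fun ij : 'I_n * 'I_n => c ij.1 ij.2).
exists N; rewrite BE => _ [a ->]; rewrite AE.
pose b j := \sum_i val (a i) * (unif pi ^+ N * c i j).
have /choice[b' bE] j : exists b' : O, val b' = b j.
  apply: val_ge_int; apply: (big_ind (val_ge v 0)); first by rewrite /val_ge eqxx.
  - by move=> x y; exact: val_geD.
  - move=> i _; rewrite -[0]addr0; apply: val_geM; first exact: int_val_ge.
    exact: (Nc N (i, j)).
exists b'; under [RHS]eq_bigr do rewrite bE scaler_suml.
rewrite exchange_big scaler_sumr; apply: eq_bigr => i _.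
rewrite cE !scaler_sumr; apply: eq_bigr => j _.
by rewrite !scalerA mulrCA mulrA.
Qed.

Lemma lattice_absorb1 (A : subrep VO) (x : V) : lat A ->
  exists N, A (unif pi ^+ N *: x).
Proof.
move=> /lattice_basis[e De AE]; have [c xE _] := Delta_expand x De.
have [N Nc] := pi_pow_int c; exists N; rewrite AE.
have /choice[a aE] i : exists a : O, val a = unif pi ^+ N * c i.
  by apply: val_ge_int; exact: Nc.
by exists a; rewrite {1}xE scaler_sumr; apply: eq_bigr => i _; rewrite aE scalerA.
Qed.

Definition mkslat (A : subrep VO) (latA : lat A) : stable_lattice v rho.
Proof.
exists (A : set V) => // g; apply/seteqP; split=> [_ [x Ax <-]|x Ax].
  exact: (subrepG g Ax).
exists (rho g^-1%g x); first exact: (subrepG g^-1%g Ax).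
by rewrite -actM mulgV act1.
Defined.

Lemma slat_sub_lat (L : stable_lattice v rho) : lat (slat_sub L).
Proof. exact: slat_lattice L. Qed.

End LatticeTheory.

(** * Reductions of lattices *)

Section ReductionTheory.
Variables (K : fieldType) (v : dvaluation K) (pi : uniformizer v).
Variables (G : groupType) (V : vectType K) (rho : repn G V).
Local Notation O := (OK v).
Local Notation FF := (residue pi).
Local Notation VO := (res_rep v rho).
Local Notation lat A := (is_lattice v ((A : subrep VO) : set V)).
Local Notation siso := (subquo_iso (residue_pi pi)).
Local Notation siso_id := (subquo_iso (@idfun FF)).

Lemma residue_pi_surj (a : FF) : exists b, residue_pi pi b = a.
Proof. by exists (repr a); exact: residue_pi_repr. Qed.

Variable L : stable_lattice v rho.
Local Notation LO := (slat_sub L).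
Local Notation red := (reduction pi L).

Lemma modpi0P (y : slat_rep L) :
  modpi pi y = 0 <-> LO ((unif pi)^-1 *: (val (y : srep_type LO) : V)).
Proof.
rewrite /modpi -(raddf0 (qrep_pi (pi_sub pi (slat_rep L)))) qrep_piP subr0 /=.
split=> [[z ->]|h].
  rewrite (_ : (unif pi)^-1 *: _ = val (z : srep_type LO)); first exact: srep_valP.
  exact: (scalerK (unif_neq0 pi) (val (z : srep_type LO) : V)).
exists (srep_proj LO ((unif pi)^-1 *: (val (y : srep_type LO) : V))).
apply: (val_inj : injective (val : srep_type LO -> _)).
rewrite -[LHS](scalerKV (unif_neq0 pi) (val (y : srep_type LO) : V)).
by rewrite -[X in _ *: X](@srep_projK _ _ _ LO _ h).
Qed.

Lemma normalisedP (x : V) :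
  normalised_at pi x L <-> LO x /\ ~ LO ((unif pi)^-1 *: x).
Proof.
split=> [[y [<- y0]]|[Lx nLx]].
  by split; [exact: srep_valP|move=> /modpi0P y0'; rewrite y0' eqxx in y0].
exists (srep_proj LO x); split; first exact: srep_projK.
by apply/eqP => /modpi0P; rewrite srep_projK.
Qed.

(** * Subrepresentations of [L / pi L] as submodules between [pi L] and [L] *)

Definition redmap (x : VO) : red := modpi pi (srep_proj LO x).

Lemma redmapP :
  [/\ forall x y, LO x -> LO y -> redmap (x + y) = redmap x + redmap y,
      forall a x, LO x -> redmap (a *: x) = residue_pi pi a *: redmap x,
      forall g x, LO x -> redmap (rep_act VO g x) = rep_act red g (redmap x),
      forall z, exists2 x, LO x & redmap x = z &
      forall x, LO x -> (redmap x = 0 <-> scalesub (unif pi) LO x)].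
Proof.
rewrite /redmap /modpi; split.
- by move=> x y Lx Ly; rewrite srep_projD // raddfD.
- move=> a x Lx; rewrite srep_projZ // linearZ.
  exact/esym/(modpi_scaleE a (qrep_pi (pi_sub pi (slat_rep L)) (srep_proj LO x))).
- by move=> g x Lx; rewrite srep_projG // -qrep_funE.
- move=> z; exists (val (repr (z : qrep_type _) : srep_type LO)).
    exact: srep_valP.
  by rewrite srep_valK; exact: qrep_pi_repr.
- by move=> x Lx; have := modpi0P (srep_proj LO x); rewrite srep_projK.
Qed.

Definition redpre (U : subrep red) : subrep VO.
Proof.
exists [set x | LO x /\ U (redmap x)]; have [fD fZ fG fS fQ] := redmapP.
- split; first exact: (subrep0 LO).
  rewrite (fQ 0 (subrep0 LO)).2; [exact: subrep0|exact: (subrep0 (scalesub _ _))].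
- move=> x y [Lx Ux] [Ly Uy]; split; first exact: (subrepD Lx Ly).
  by rewrite fD //; exact: subrepD.
- move=> a x [Lx Ux]; split; first exact: (subrepZ a Lx).
  by rewrite fZ //; exact: subrepZ.
- move=> g x [Lx Ux]; split; first exact: (subrepG g Lx).
  by rewrite [redmap _](fG g x Lx); exact: subrepG.
Defined.

Definition redim (A : subrep VO) : subrep red.
Proof.
exists [set z | exists x, [/\ LO x, A x & redmap x = z]].
all: have [fD fZ fG fS fQ] := redmapP.
- exists 0; split; [exact: (subrep0 LO)|exact: (subrep0 A)|].
  by apply/(fQ 0 (subrep0 LO)); exact: (subrep0 (scalesub _ _)).
- move=> _ _ [x [Lx Ax <-]] [y [Ly Ay <-]]; exists (x + y).
  by split; [exact: (subrepD Lx Ly)|exact: (subrepD Ax Ay)|rewrite fD].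
- move=> a _ [x [Lx Ax <-]]; have [b <-] := residue_pi_surj a; exists (b *: x).
  by split; [exact: (subrepZ b Lx)|exact: (subrepZ b Ax)|rewrite fZ].
- move=> g _ [x [Lx Ax <-]]; exists (rep_act VO g x).
  by split; [exact: (subrepG g Lx)|exact: (subrepG g Ax)|exact: fG].
Defined.

Lemma redpre_iso (U1 U0 : subrep red) (Y : rep FF G) :
  siso_id U1 U0 Y -> siso (redpre U1) (redpre U0) Y.
Proof.
have [fD fZ fG fS fQ] := redmapP.
move=> [h [hD hZ hG hS hQ]]; exists (h \o redmap); split=> /=.
- by move=> x y [Lx Ux] [Ly Uy]; rewrite fD // hD.
- by move=> a x [Lx Ux]; rewrite fZ // hZ.
- by move=> g x [Lx Ux]; rewrite [redmap _](fG g x Lx) hG.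
- move=> z; have [y Uy <-] := hS z; have [x Lx fx] := fS y.
  by exists x; rewrite ?fx //; split; rewrite ?fx.
- by move=> x [Lx Ux]; rewrite hQ //; split=> [|[]].
Qed.

Lemma redpre_le (U1 U0 : subrep red) : redpre U0 `<=` redpre U1 <-> U0 `<=` U1.
Proof.
have [_ _ _ fS _] := redmapP; split=> [h z Uz|h x [Lx /h Ux]//].
by have [x Lx fx] := fS z; rewrite -fx; apply: (h x _).2; rewrite /= fx.
Qed.

Lemma redpre_sub (U : subrep red) : redpre U `<=` LO.
Proof. by move=> x []. Qed.

Lemma scale_pi_sub (A : subrep VO) : scalesub (unif pi) A `<=` A.
Proof.
move=> x /= Ax; have := subrep_int (pi_int pi 1) Ax.
by rewrite expr1 scalerKV // unif_neq0.
Qed.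

Lemma pi_sub_redpre (U : subrep red) : scalesub (unif pi) LO `<=` redpre U.
Proof.
have [_ _ _ _ fQ] := redmapP; move=> x piLx; have Lx := scale_pi_sub piLx.
by split=> //; rewrite (fQ x Lx).2 //; exact: subrep0.
Qed.

Lemma redpre0 : redpre (subrep_zero red) `<=` scalesub (unif pi) LO.
Proof. by have [_ _ _ _ fQ] := redmapP; move=> x [Lx /fQ]; exact. Qed.

Lemma redimP (A : subrep VO) x : scalesub (unif pi) LO `<=` A -> LO x ->
  (redim A (redmap x) <-> A x).
Proof.
have [fD _ _ _ fQ] := redmapP; move=> piA Lx; split=> [[y [Ly Ay]]|Ax]; last by exists x.
move=> /(subquo_iso_eq fD fQ Ly Lx)/piA Ayx.
by rewrite -(subKr y x); exact: (subrepB Ay Ayx).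
Qed.

Lemma redpreK (A : subrep VO) : scalesub (unif pi) LO `<=` A -> A `<=` LO ->
  redpre (redim A) = A :> set VO.
Proof.
move=> piA AL; apply/seteqP; split=> [x [Lx /redimP]|x Ax]; first exact.
by have Lx := AL x Ax; split=> //; apply/redimP.
Qed.

Lemma redimK (U : subrep red) : redim (redpre U) = U :> set red.
Proof.
have [_ _ _ fS _] := redmapP.
apply/seteqP; split=> [_ [x [_ [_ Ux] <-]]//|z Uz].
by have [x Lx fx] := fS z; exists x; split=> //; split=> //; rewrite fx.
Qed.

Let latLO : lat LO. Proof. exact: slat_sub_lat. Qed.

Let latpi : lat (scalesub (unif pi) LO).
Proof. by apply: scalesub_lat => //; exact: unif_neq0. Qed.

Lemma redpre_lat (U : subrep red) : lat (redpre U).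
Proof. apply: (lattice_sandwich pi latpi latLO); [exact: pi_sub_redpre|exact: redpre_sub]. Qed.

(** Preimages in [V] lie between the lattices [pi L] and [L], where [lattice_max] applies. *)
Lemma red_noetherian : noetherian red.
Proof.
move=> p [A pA].
have [||_ [U pU <-] maxU] := @lattice_max _ _ pi _ _ _ _ _ (redpre @` p) latpi latLO.
- by exists (redpre A), A.
- by move=> _ [U _ <-]; split; [exact: pi_sub_redpre|exact: redpre_sub].
exists U => // B pB /redpre_le UB; apply/redpre_le; exact: maxU.
Qed.

Lemma red_artinian : artinian red.
Proof.
move=> p [A pA].
have [||_ [U pU <-] minU] := @lattice_min _ _ pi _ _ _ _ _ (redpre @` p) latpi latLO.
- by exists (redpre A), A.
- by move=> _ [U _ <-]; split; [exact: pi_sub_redpre|exact: redpre_sub].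
exists U => // B pB /redpre_le UB; apply/redpre_le; exact: minU.
Qed.

(** The factor [P / Q] lives in [V] over the ring of integers, the layer [U1 / U0] over the residue
    field. [semisimple_layer] is applied to preimages in [V] and its answer is pushed forward by
    [redim]. *)
Lemma red_layer (U1 U0 : subrep red) (P Q : subrep VO) (X : rep FF G) : U0 `<=` U1 ->
  (forall C : subrep red, U0 `<=` C ->
     (forall Z, simpleq Z U0 -> Z `<=` U1 -> Z `<=` C) -> U1 `<=` C) ->
  irreducible X -> siso P Q X -> Q `<=` P ->
  capsub P (redpre U0) `<=` Q -> ~ capsub P (redpre U1) `<=` Q ->
  exists Z, [/\ simpleq Z U0, Z `<=` U1 & siso_id Z U0 X].
Proof.
move=> U01 gen irrX iso QP PU0 PU1.
have piU0 (Z : subrep VO) : redpre U0 `<=` Z -> scalesub (unif pi) LO `<=` Z.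
  by move=> U0Z; apply: subset_trans U0Z; exact: pi_sub_redpre.
have isoim (Z : subrep VO) : redpre U0 `<=` Z -> Z `<=` redpre U1 ->
    siso Z (redpre U0) (subquo (redim Z) U0).
  move=> U0Z ZU1; apply: (@subquo_iso_eqset _ _ _ _ _ (redpre (redim Z)) _ (redpre U0)) => //.
    by apply: redpreK; [exact: piU0|by move=> x /ZU1[]].
  exact/redpre_iso/subquo_isoP.
have [|||Z' [simZ' Z'U1 isoZ']] := semisimple_layer residue_pi_surj
  ((redpre_le U1 U0).2 U01) _ _ _ irrX iso QP PU0 PU1.
- move=> p pA sand; apply: (lattice_max pi _ _ pA sand); exact: redpre_lat.
- move=> C U0C genC.
  suff h : U1 `<=` redim C by move=> x [Lx /h/redimP]; apply=> //; exact: piU0.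
  apply: gen => [z U0z|Z simZ ZU1].
    by move: U0z; rewrite -redimK => -[x [Lx /U0C Cx <-]]; exists x.
  have [U0Z _ _] := simZ.
  have sim : simpleq (redpre Z) (redpre U0).
    apply: (subquo_iso_irr residue_pi_surj).
    + exact/redpre_le.
    + exact/redpre_iso/subquo_isoP.
    + exact: subquo_irr.
  have ZC := genC _ sim ((redpre_le _ _).2 ZU1).
  by move=> z; rewrite -redimK => -[x [Lx /ZC Cx <-]]; exists x.
- by move=> Z [U0Z _ _] ZU1; exists (subquo (redim Z) U0); exact: isoim.
have [U0Z' _ _] := simZ'.
have XY := subquo_iso_unique residue_pi_surj (isoim _ U0Z' Z'U1) isoZ'.
have isoZ : siso_id (redim Z') U0 X by exact: subquo_iso_riso (subquo_isoP _ _) XY.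
have U0Z : U0 `<=` redim Z'.
  by move=> z; rewrite -redimK => -[x [Lx /U0Z' Zx <-]]; exists x.
exists (redim Z'); split=> //.
  exact: (subquo_iso_irr (@idfun_surj FF) U0Z isoZ irrX).
by move=> _ [x [Lx /Z'U1[_ Ux] <-]].
Qed.

(* Comparing with the lattices [c L] locates the factor in a single layer. *)
Lemma constituent_layer (U : nat -> subrep red) l (A1 A0 : subrep VO) (X : rep FF G) :
  (forall k, (k < l)%N -> U k `<=` U k.+1) ->
  U 0%N `<=` [set 0] -> [set: red] `<=` U l ->
  (forall k, (k < l)%N -> forall C : subrep red, U k `<=` C ->
     (forall Z, simpleq Z (U k) -> Z `<=` U k.+1 -> Z `<=` C) -> U k.+1 `<=` C) ->
  lat A1 -> lat A0 -> A0 `<=` A1 -> irreducible X -> siso A1 A0 X ->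
  exists k Z, [/\ (k < l)%N, simpleq Z (U k), Z `<=` U k.+1 & siso_id Z (U k) X].
Proof.
move=> Usub U0 Ul gen lat1 lat0 A01 irrX iso.
have [_ nA10 _] := subquo_iso_irr residue_pi_surj A01 iso irrX.
have [N1 A1L] := lattice_absorb pi latLO lat1.
have [N2 LA0] := lattice_absorb pi lat0 latLO.
have p0 k : unif pi ^+ k != 0 by rewrite expf_neq0 ?unif_neq0.
(* [c t] is [pi^(N1 - t)]. For [t = 0] the lattice [c t A1] lies in [L]; for [t = N1 + N2] the
   lattice [c t A0] contains [L]. *)
pose c t := unif pi ^+ N1 / unif pi ^+ t.
have c0 t : c t != 0 by rewrite mulf_neq0 ?invr_neq0.
pose q t := capsub (scalesub (c t) A1) LO `<=` scalesub (c t) A0.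
have exq : exists t, `[< q t >].
  exists (N1 + N2)%N; apply/asboolP => x [_ Lx] /=.
  rewrite /c invfM invrK exprD mulrA mulVf // mul1r; exact: LA0.
case: (ex_minnP exq) => t /asboolP qt mint.
have nq0 : ~ q 0%N.
  move=> q0; apply: nA10 => x Ax; have := q0 (unif pi ^+ N1 *: (x : V)).
  rewrite /= /c expr0 divr1 scalerK //; apply; split=> //; exact: A1L.
case: t => [//|t] in qt mint *.
have nqt : ~ q t by move=> /asboolP/mint; rewrite ltnn.
pose P := scalesub (c t) A1; pose Q := scalesub (c t) A0.
(* [r k] says that step [k] detects [P / Q]. It fails at 0 and holds at [l], so the factor appears
   at the least [k] where it holds. *)
pose r k := ~ capsub P (redpre (U k)) `<=` Q.
have rl : r l.
  by move=> h; apply: nqt => x [Px Lx]; apply: h; split=> //; split=> //; apply: Ul.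
have exr : exists k, `[< r k >] by exists l; apply/asboolP.
case: (ex_minnP exr) => k /asboolP rk mink.
(* Scaling [qt] by [pi] puts [P] meet [pi L] in [Q], and the preimage of step 0 lies in [pi L]. *)
have nr0 : ~ r 0%N.
  apply; move=> x [Px [Lx /U0 fx]].
  have piLx : scalesub (unif pi) LO x by apply: redpre0; split.
  have cE : (c t.+1)^-1 * (unif pi)^-1 = (c t)^-1.
    rewrite -invfM /c exprSr; congr _^-1.
    by rewrite invfM mulrA divfK // unif_neq0.
  rewrite /Q /= -cE -scalerA; apply: qt; split=> //=.
  by rewrite scalerA cE.
case: k => [//|k] in rk mink *.
have kl : (k < l)%N by apply: mink; apply/asboolP.
have nrk : capsub P (redpre (U k)) `<=` Q.
  by apply: contrapT => /asboolP/mink; rewrite ltnn.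
have QP : Q `<=` P by move=> x /A01.
have isoPQ : siso P Q X by exact: scalesub_iso.
have [Z [simZ ZU isoZ]] := red_layer (Usub k kl) (gen k kl) irrX isoPQ QP nrk rk.
by exists k, Z.
Qed.

End ReductionTheory.

(** * Maximal lattices *)

Section Completeness.
Variables (K : fieldType) (v : dvaluation K) (pi : uniformizer v).
Hypothesis K_complete : complete_valued v.

(** The ultrametric inequality makes [u] Cauchy from consecutive differences alone; the bound passes
    to the limit by comparison with a term of large index. *)
Lemma complete_limit (u : nat -> K) :
  (forall j : nat, val_ge v j%:Z (u j.+1 - u j)) ->
  exists l, forall j : nat, val_ge v j%:Z (l - u j).
Proof.
move=> du.
have dist j k : (j <= k)%N -> val_ge v j%:Z (u k - u j).
  move=> /subnK <-; elim: (k - j)%N => [|i IH]; first by rewrite add0n subrr /val_ge eqxx.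
  rewrite -(subrKA (u (i + j)%N)); apply: val_geD => //.
  by apply: val_ge_le (du _); rewrite lez_nat leq_addl.
pose F : set_system (valued v) := (u : nat -> valued v) @ \oo.
have cF : cauchy F.
  move=> A [m _ mA]; pose N := `|m|%N.
  have tail : F [set x | exists2 k, (N <= k)%N & x = u k] by exists N => // k Nk; exists k.
  exists ([set x | exists2 k, (N <= k)%N & x = u k],
          [set x | exists2 k, (N <= k)%N & x = u k]) => //.
  move=> [_ _] [/= [j Nj ->] [k Nk ->]]; apply: mA => /=.
  apply: (@val_ge_le _ _ m N%:Z); first by rewrite /N abszE ler_norm.
  rewrite -(subrKA (u N)); apply: val_geD; first exact: dist.
  by rewrite -opprB; apply: val_geN; exact: dist.
have cvF : cvg F by apply: K_complete.
exists (lim F) => j.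
have : nbhs (lim F) [set y | val_ge v j%:Z ((lim F : K) - y)].
  rewrite -nbhs_entourageE; exists [set xy | val_ge v j%:Z ((xy.1 : K) - xy.2)].
    by exists j%:Z.
  by move=> y /xsectionP.
move=> /cvF[N _ hN]; have := hN (maxn N j) (leq_maxl _ _) => /= h.
rewrite -(subrKA (u (maxn N j))); apply: val_geD => //.
exact/dist/leq_maxr.
Qed.

Variables (G : groupType) (V : vectType K) (rho : repn G V).
Local Notation VO := (res_rep v rho).
Local Notation lat A := (is_lattice v ((A : subrep VO) : set V)).

Let p0 k : unif pi ^+ k != 0. Proof. by rewrite expf_neq0 ?unif_neq0. Qed.

Lemma scale_pi_le (A : subrep VO) j k : (j <= k)%N ->
  scalesub (unif pi ^+ k) A `<=` scalesub (unif pi ^+ j) A.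
Proof.
move=> jk x /= Ax; have := subrep_int (pi_int pi (k - j)) Ax; congr (A _).
rewrite scalerA -{2}(subnK jk) exprD invfM mulrA mulfV ?mul1r //.
Qed.

(** Completeness is applied to each coordinate in a basis of [A]; [s t i] is the coordinate of [u t]
    along [e i]. *)
Lemma lattice_complete (A : subrep VO) (u : nat -> V) : lat A ->
  (forall t, scalesub (unif pi ^+ t) A (u t.+1 - u t)) ->
  exists l : V, forall t, scalesub (unif pi ^+ t) A (l - u t).
Proof.
move=> /(lattice_basis pi)[e De AE] du.
have /choice[a aE] t : exists a : 'I_(\dim {:V}) -> OK v,
    (unif pi ^+ t)^-1 *: (u t.+1 - u t) = \sum_i val (a i) *: e i.
  by have := du t; rewrite /= AE.
have [b bE _] := Delta_expand (u 0%N) De.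
pose s := fix s t i := if t is t'.+1 then s t' i + unif pi ^+ t' * val (a t' i) else b i.
have sE t : u t = \sum_i s t i *: e i.
  elim: t => [//|t IH] /=.
  under eq_bigr do rewrite scalerDl -scalerA.
  by rewrite big_split /= -scaler_sumr -IH -aE scalerKV // addrC subrK.
have /choice[l lE] i : exists l, forall j : nat, val_ge v j%:Z (l - s j i).
  apply: complete_limit => j /=; rewrite addrC addKr -[j%:Z]addr0.
  by apply: val_geM; [rewrite /val_ge dvalX lexx orbT|exact: int_val_ge].
exists (\sum_i l i *: e i) => t /=; rewrite AE.
have /choice[c cE] i : exists c : OK v, val c = (unif pi ^+ t)^-1 * (l i - s t i).
  apply: val_ge_int; rewrite -(subrr t%:Z) addrC; apply: val_geM => //.
  by rewrite /val_ge dvalV // dvalX lexx orbT.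
exists c; rewrite sE -sumrB scaler_sumr; apply: eq_bigr => i _.
by rewrite cE -scalerBl scalerA.
Qed.

(* Mittag-Leffler: modulo each power of the uniformiser, the images of the
   submodules [A] meet [pi^k M] stabilise, so a vector outside [pi A] can be
   lifted through all of them. *)
Lemma unbounded_line (A M : subrep VO) : lat A -> A `<=` M ->
  (forall N, ~ forall x, M x -> A (unif pi ^+ N *: (x : V))) ->
  exists2 l : V, l != 0 & forall k, M ((unif pi ^+ k)^-1 *: l).
Proof.
move=> latA AM unb.
pose Mk k := capsub A (scalesub (unif pi ^+ k) M).
pose piA j := scalesub (unif pi ^+ j) A.
have latpi j : lat (piA j) by exact: scalesub_lat.
have piA_sub j : piA j `<=` A.
  by move=> x /(scale_pi_le (leq0n j)); rewrite /= expr0 invr1 scale1r.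
have Mk_le j k : (j <= k)%N -> Mk k `<=` Mk j.
  by move=> jk x [Ax /(scale_pi_le jk) Mx].
(* Take [x] in [M] with [pi^k x] outside [A], and the least [j] with [pi^j x] in [A]. Then [j > k],
   so [pi^j x] is in [pi^k M], and minimality keeps it out of [pi A]. *)
have prim k : exists2 w, Mk k w & ~ piA 1%N w.
  have [x Mx nAx] : exists2 x, M x & ~ A (unif pi ^+ k *: (x : V)).
    by apply: contrapT => h; apply: (unb k) => x Mx; apply: contrapT => nA; apply: h; exists x.
  have exj : exists j, `[< A (unif pi ^+ j *: (x : V)) >].
    by have [j Aj] := lattice_absorb1 pi (x : V) latA; exists j; apply/asboolP.
  case: (ex_minnP exj) => j /asboolP Aj minj.
  have kj : (k < j)%N.
    rewrite ltnNge; apply/negP => jk; apply: nAx.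
    have := subrep_int (pi_int pi (k - j)) Aj.
    by rewrite scalerA -exprD subnK.
  exists (unif pi ^+ j *: (x : V)).
    split=> //=; rewrite scalerA -(subnK (ltnW kj)) exprD mulrCA mulVf // mulr1.
    exact/subrep_int/Mx/pi_int.
  rewrite /= expr1 => h; have : (j <= j.-1)%N.
    apply: minj; apply/asboolP; move: h; congr (A _).
    rewrite -{1}(ltn_predK kj) exprS -scalerA scalerK //; exact: unif_neq0.
  by rewrite leqNgt (ltn_predK kj) leqnn.
(* The decreasing submodules [addsub (Mk k) (piA j)] lie between the lattices [piA j] and [A], so
   [lattice_min] makes them stationary. *)
have stab j : exists k0, forall k, Mk k0 `<=` addsub (Mk k) (piA j).
  have [||_ [k0 _ <-] mink] := @lattice_min _ _ pi _ _ _ (piA j) A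
    [set addsub (Mk k) (piA j) | k in [set: nat]] (latpi j) latA.
  - by exists (addsub (Mk 0%N) (piA j)), 0%N.
  - move=> _ [k _ <-]; split; first exact: addsubr.
    by apply: addsub_sub => //; exact: capsubl.
  exists k0 => k; have [kk|/ltnW kk] := leqP k k0.
    by move=> x /(Mk_le _ _ kk); exact: addsubl.
  apply: subset_trans (@addsubl _ _ _ (Mk k0) (piA j)) _.
  apply: mink; first by exists k.
  apply: addsub_sub; last exact: addsubr.
  by apply: subset_trans (Mk_le _ _ kk) _; exact: addsubl.
(* [Nj j u] says that [u] lies in the stable image modulo [pi^j A]; [step] refines such a vector by
   one power of [pi]. *)
pose Nj j (u : V) := forall k, addsub (Mk k) (piA j) u.
have /choice[step stepP] ju : exists u' : V, Nj ju.1 ju.2 ->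
    Nj ju.1.+1 u' /\ piA ju.1 (u' - ju.2).
  case: ju => j u /=; have [Nu|nN] := pselect (Nj j u); last by exists 0.
  have [k0 k0P] := stab j.+1; have [y [z [My piz uE]]] := Nu k0.
  exists y => _; split; first by move=> k; exact: k0P.
  rewrite uE [_ - _](_ : _ = - z); last by rewrite opprD addrA subrr add0r.
  exact: (subrepN piz).
have [k1 k1P] := stab 1%N; have [w0 Mw0 nw0] := prim k1.
(* Index shift: [u t] lies in the stable image modulo [pi^(t+1) A]. The start [w0] is outside
   [pi A], which keeps the limit nonzero. *)
pose u := fix u t := if t is t'.+1 then step (t'.+1, u t') else (w0 : V).
have uN t : Nj t.+1 (u t).
  elim: t => [|t IH]; first by move=> k; exact: k1P.
  exact: (stepP (t.+1, u t) IH).1.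
have du t : piA t.+1 (u t.+1 - u t) := (stepP (t.+1, u t) (uN t)).2.
have [l lE] := lattice_complete latA (fun t => scale_pi_le (leqnSn t) (du t)).
exists l => [|k].
  apply/eqP => l0; apply: nw0.
  have h := subrepD (lE 1%N) (du 0%N); have : piA 1%N (- (l - w0)).
    by apply: subrepN; move: h; congr (piA _ _); rewrite addrA subrK.
  by rewrite l0 sub0r opprK.
(* Both [l - u k] and the error term [z] of [u k] lie in [pi^k A], hence in [pi^k M]. *)
have piM : piA k `<=` scalesub (unif pi ^+ k) M by move=> x /AM.
have [y [z [[_ My] piz uE]]] := uN k k.
have : scalesub (unif pi ^+ k) M (l - u k + (y + z)).
  apply: subrepD; first exact: piM (lE k).
  apply: subrepD => //; apply: piM; exact: scale_pi_le (leqnSn k) _ piz.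
by rewrite -uE [_ + _](subrK (u k) l).
Qed.

Lemma maximal_lattice_exists (A : subrep VO) (x : V) : irreducible (Rep rho) ->
  lat A -> A x -> ~ A ((unif pi)^-1 *: x) ->
  exists2 L : stable_lattice v rho, A `<=` L & maximal_wrt pi x L.
Proof.
move=> [_ irr] latA Ax nAx.
pose good (M : subrep VO) := A `<=` M /\ ~ M ((unif pi)^-1 *: x).
pose P (S : set V) := S = set0 \/ exists2 M : subrep VO, S = M & good M.
have [F FP tot|S [PS maxS]] := @Zorn_bigcup _ P.
  have [[S FS S0]|h] := pselect (exists2 S, F S & S !=set0); last first.
    left; apply/seteqP; split=> // y [S FS Sy]; case: h; exists S => //.
    by exists y.
  have FM T y : F T -> T y -> exists2 M : subrep VO, T = M & good M.
    by move=> /FP[->//|].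
  have [y Sy] := S0; have [M SM [AM _]] := FM _ _ FS Sy.
  pose U := \bigcup_(T in F) T.
  have AU : A `<=` U by move=> z /AM Mz; exists S => //; rewrite SM.
  have preP : exists N : subrep VO, (N : set V) = U.
    unshelve eexists; first exists U; last by [].
    - by apply: AU; exact: subrep0.
    - move=> a b [T FT Ta] [T' FT' T'b].
      have [TM [N EN _]] := (FM _ _ FT Ta, FM _ _ FT' T'b).
      have [N' EN' _] := TM.
      have [TT|TT] := tot T T' FT FT'.
        by exists T' => //; rewrite EN; apply: subrepD; rewrite -EN //; exact: TT.
      by exists T => //; rewrite EN'; apply: subrepD; rewrite -EN' //; exact: TT.
    - move=> a b [T FT Tb]; exists T => //; have [N EN _] := FM _ _ FT Tb.
      by rewrite EN; apply: subrepZ; rewrite -EN.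
    - move=> g b [T FT Tb]; exists T => //; have [N EN _] := FM _ _ FT Tb.
      by rewrite EN; apply: subrepG; rewrite -EN.
  have [N NU] := preP; right; exists N; first exact/esym.
  split; rewrite NU //.
  move=> [T FT Tx]; have [N' EN [_]] := FM _ _ FT Tx; apply.
  by rewrite -EN.
have [S0|[M SM [AM nMx]]] := PS.
  case: (maxS A); last by right; exists A => //; split.
  by rewrite S0; split=> // h; have := h x Ax.
have [N MN] : exists N, forall y, M y -> A (unif pi ^+ N *: (y : V)).
  apply: contrapT => /forallNP unb.
  have [l l0 lM] := unbounded_line latA AM unb.
  (* [D] is the largest [K]-subspace inside [M]. It is [G]-stable and contains [l], so
     irreducibility makes it all of [V], although [pi^-1 x] is not in [M]. *)
  have [D DP] : exists D : subrep (Rep rho), forall y, D y <-> forall k, M ((unif pi ^+ k)^-1 *: y).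
    unshelve eexists; first exists [set y : V | forall k, M ((unif pi ^+ k)^-1 *: y)].
    - by move=> k; rewrite scaler0; exact: (subrep0 M).
    - by move=> y z My Mz k; rewrite scalerDr; exact: (subrepD (My k) (Mz k)).
    - move=> a y My k; have [N aN] := pi_pow_int pi (fun _ : 'I_1 => a).
      suff -> : (unif pi ^+ k)^-1 *: (a *: (y : V)) =
          (unif pi ^+ N * a) *: ((unif pi ^+ (k + N))^-1 *: (y : V)).
        exact: subrep_int (aN N ord0 (leqnn N)) (My (k + N)%N).
      rewrite !scalerA exprD invfM; congr (_ *: _).
      by rewrite [_ * a in RHS]mulrC mulrACA mulfV // mulr1 mulrC.
    - by move=> g y My k; have := subrepG g (My k); rewrite /= /res_fun linearZ.
    by [].
  have [D0|DT] := irr D.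
    have : D l by apply/DP.
    by rewrite D0 => /= l0'; rewrite l0' eqxx in l0.
  have : D x by rewrite DT.
  by move=> /DP/(_ 1%N); rewrite expr1.
have latM : lat M.
  apply: (lattice_sandwich pi latA (scalesub_lat (invr_neq0 (p0 N)) latA) AM).
  by move=> y /MN; rewrite /= invrK.
exists (mkslat latM) => //; split.
  by apply/normalisedP; split; [exact: AM|exact: nMx].
move=> L' /normalisedP[L'x nL'x] LL'; apply: contrapT => nLL'.
apply: (maxS L'); first by rewrite SM; split.
right; exists (slat_sub L') => //; split=> //.
by apply: subset_trans AM _.
Qed.

End Completeness.

(** * Constituents of the residual representation *)

Section Constituents.
Variables (K : fieldType) (v : dvaluation K) (pi : uniformizer v).
Variables (G : groupType) (V : vectType K) (rho : repn G V).
Variables (r : nat) (W : 'I_r -> rep (residue pi) G) (m : 'I_r -> nat).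
Hypothesis W_irreducible : forall i, irreducible (W i).
Hypothesis m_ge1 : forall i, (1 <= m i)%N.
Hypothesis rho_ss : riso (residual_ss pi rho) (dsum (fun i => rpow (W i) (m i))).
Local Notation VO := (res_rep v rho).
Local Notation lat A := (is_lattice v ((A : subrep VO) : set V)).
Local Notation siso := (subquo_iso (residue_pi pi)).

Lemma residual_constituents (i0 : 'I_r) :
  exists (L : stable_lattice v rho) (C : comp_series (reduction pi L)),
    (forall k, (k < cs_len C)%N -> exists i, riso (subquo (C k.+1) (C k)) (W i)) /\
    (forall i, exists2 k, (k < cs_len C)%N & riso (W i) (subquo (C k.+1) (C k))).
Proof.
(* Without a stable lattice [residual_ss] would be an empty sum, which cannot contain [W i0]; so the
   index [i0] yields a lattice. *)
move: rho_ss; rewrite /residual_ss; case: pselect => [h|nh] iso; last first.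
  have [|_ /(_ i0)[[]]//] := dsum_constituents _ W_irreducible m_ge1 iso.
  by case.
exists (sval (cid h)); move: (sval (cid h)) iso => L; rewrite /semisimplification.
case: pselect => [h'|[]]; last first.
  exact: comp_series_exists (@red_noetherian _ _ pi _ _ _ L) (@red_artinian _ _ pi _ _ _ L).
move: (sval (cid h')) => C iso; exists C.
have [|CW WC] := dsum_constituents _ W_irreducible m_ge1 iso.
  by move=> k; exact: cs_irr.
split=> [k kC|i]; first exact: CW (Ordinal kC).
by have [k iso'] := WC i; exists k.
Qed.

(** A Jordan-Hoelder argument across lattices: [constituent_layer] finds the factor in a layer of a
    composition series of one fixed reduction, and that layer is simple. *)
Lemma constituent_in_W (i0 : 'I_r) (A1 A0 : subrep VO) (X : rep (residue pi) G) :
  lat A1 -> lat A0 -> A0 `<=` A1 -> irreducible X -> siso A1 A0 X ->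
  exists i, riso X (W i).
Proof.
move=> lat1 lat0 A01 irrX iso; have [L [C [CW _]]] := residual_constituents i0.
have simC k : (k < cs_len C)%N -> simpleq (C k.+1) (C k).
  move=> kC; apply: (subquo_iso_irr (@idfun_surj (residue pi))).
  - exact: cs_sub.
  - exact: subquo_isoP.
  - exact: cs_irr.
have [|||k [Z [kC simZ ZC isoZ]]] := @constituent_layer _ _ pi _ _ _ L C (cs_len C)
  A1 A0 X (@cs_sub _ _ _ C) _ _ _ lat1 lat0 A01 irrX iso.
- by rewrite cs_bot.
- by rewrite cs_top.
- by move=> k kC D CD h; apply: (h (C k.+1)) => //; exact: simC.
have [i isoW] := CW k kC; exists i; apply: riso_trans isoW.
have [_ _ sC] := simC k kC; have [CZ nZC _] := simZ.
have ZE : Z = C k.+1 :> set _.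
  by apply/seteqP; split=> //; have [|] := sC Z CZ ZC.
apply: (subquo_iso_unique (@idfun_surj (residue pi))) (subquo_isoP _ _).
exact: subquo_iso_eqset ZE _ isoZ.
Qed.

Lemma W_constituent (i : 'I_r) : exists A1 A0 : subrep VO,
  [/\ lat A1, lat A0, A0 `<=` A1 & siso A1 A0 (W i)].
Proof.
have [L [C [_ WC]]] := residual_constituents i; have [k kC iso] := WC i.
exists (redpre (C k.+1)), (redpre (C k)); split; try exact: redpre_lat.
  by apply/redpre_le; exact: cs_sub.
exact/redpre_iso/(subquo_iso_riso (subquo_isoP _ _))/riso_sym.
Qed.

(** [constituent_layer] is applied to the socle filtration, the factor coming from whichever lattice
    realises [W j]. *)
Lemma W_occurs_in_level (j : 'I_r) (L : stable_lattice v rho) :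
  exists k, occurs_in_level (W j) (reduction pi L) k.
Proof.
have [A1 [A0 [lat1 lat0 A01 iso]]] := W_constituent j.
have [l lP] := soc_filt_exhaustive (@red_noetherian _ _ pi _ _ _ L) (@red_artinian _ _ pi _ _ _ L).
have [|||k [Z [_ [SZ _ _] ZS isoZ]]] := @constituent_layer _ _ pi _ _ _ L
  (soc_filt (reduction pi L)) l A1 A0 (W j) _ _ lP _ lat1 lat0 A01 (W_irreducible j) iso.
- by move=> k _; exact: soc_filt_sub.
- by [].
- by move=> k _ C; exact: soc_filt_gen.
by exists k.+1; apply/occurs_in_levelP; exists Z.
Qed.

Lemma soc_level_path (i : 'I_r) (L : stable_lattice v rho) :
  (forall i j, riso (W i) (W j) -> i = j) ->
  riso (srep (soc (reduction pi L))) (W i) ->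
  forall j k, occurs_in_level (W j) (reduction pi L) k -> bellaiche_path rho W i j k.-1.
Proof.
move=> W_noniso isoS j k; have id_surj := @idfun_surj (residue pi).
case: k => [[]//|k]; elim: k j => [|k IH] j /occurs_in_levelP[Z [SZ ZS iso]].
  (* At level 1, [Z] is a nonzero submodule of the simple socle, hence equal to it, and the empty
     path serves. *)
  have isoSW := subquo_iso_riso (srep_iso _) isoS.
  have [_ _ sS] := subquo_iso_irr id_surj (@subrep_zeroP _ _ _ _) isoSW (W_irreducible i).
  have simZ := subquo_iso_irr id_surj SZ iso (W_irreducible j).
  have [_ nZ0 _] := simZ.
  have ZE : Z = soc (reduction pi L) :> set _.
    apply/seteqP; split; first exact: soc_simple.
    by have [] := sS Z SZ (soc_simple simZ).
  have isoZ := subquo_iso_eqset ZE erefl iso.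
  by exists [::]; split=> //=; apply/W_noniso/(subquo_iso_unique id_surj isoSW isoZ).
have [N [B [T [NT simB ext occ]]]] := nonsplit_step (@red_noetherian _ _ pi _ _ _ L)
  (@red_artinian _ _ pi _ _ _ L) (W_irreducible j) SZ iso.
have [NB _ _] := simB; have irrX := subquo_irr simB.
(* The bottom [B / N] of the extension is some [W l] occurring one level lower; the path to [l] is
   prolonged by the edge from [l] to [j]. *)
have [l XW] := constituent_in_W i (@redpre_lat _ _ pi _ _ _ _ B)
  (@redpre_lat _ _ pi _ _ _ _ N) ((redpre_le _ _).2 NB) irrX
  (redpre_iso (subquo_isoP B N)).
have isoW := subquo_iso_riso (subquo_isoP B N) XW.
have [p [pp pl ps]] := IH l (occ _ (W_irreducible l) isoW).
exists (rcons p j); rewrite rcons_path last_rcons size_rcons pp ps; split=> //=.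
by rewrite pl; apply/asboolP; exists L, N, T; split=> //; exact: ext.
Qed.

(* Otherwise [pi^-1] times the preimage of [U] is a larger lattice normalised at [x]. *)
Lemma maximal_in_subrep (L : stable_lattice v rho) (x : V) (U : subrep (reduction pi L)) :
  maximal_wrt pi x L -> ~ U `<=` subrep_zero _ -> U (redmap pi L x).
Proof.
move=> [/normalisedP[Lx nLx] maxL] nU; apply: contrapT => nUx; apply: nU.
have p0 := unif_neq0 pi.
have latU : lat (scalesub (unif pi)^-1 (redpre U)).
  by apply: scalesub_lat; [exact: invr_neq0|exact: redpre_lat].
have piL y : slat_sub L y -> redpre U (unif pi *: (y : V)).
  by move=> Ly; apply: pi_sub_redpre; rewrite /= scalerK.
have h : mkslat latU `<=` L.
  apply: maxL.
    apply/normalisedP; split; first by rewrite /= invrK; exact: piL.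
    by rewrite /= invrK scalerKV // => -[].
  by move=> y Ly; rewrite /= invrK; exact: piL.
have [_ _ _ fS fQ] := redmapP pi L.
move=> z Uz; have [y Ly fy] := fS z; rewrite -fy /=; apply/fQ => //.
by apply: h; rewrite /= invrK scalerKV //; split=> //; rewrite fy.
Qed.

Lemma residue_unif : residue_pi pi (unifO pi) = 0.
Proof.
rewrite -(rmorph0 (residue_pi pi)); apply/residue_piP/pi_idealP.
by exists 1; rewrite subr0 mulr1.
Qed.

Lemma maximal_with_socle (i : 'I_r) : complete_valued v -> irreducible (Rep rho) ->
  exists L : stable_lattice v rho,
    maximal_lattice pi L /\ riso (srep (soc (reduction pi L))) (W i).
Proof.
move=> K_complete irr; have [A1 [A0 [lat1 lat0 A01 iso]]] := W_constituent i.
have p0 := unif_neq0 pi.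
have simA := subquo_iso_irr (@residue_pi_surj _ _ pi) A01 iso (W_irreducible i).
have [_ nA10 sA] := simA; have [x A1x nA0x] := not_subset nA10.
(* [A1 / A0] is a module over the residue field, so [pi] kills it. *)
have A0pi y : A1 y -> A0 (unif pi *: (y : V)).
  have [f [fD fZ fG fS fQ]] := iso; move=> A1y.
  have piy : A1 (unifO pi *: (y : VO)) by exact: subrepZ.
  by apply/(fQ _ piy); rewrite fZ // residue_unif scale0r.
(* The maximal lattice is built over [pi^-1 A0], which contains [x] by [A0pi] but not [pi^-1 x], as
   [x] is outside [A0]. *)
have [|||L AL maxL] := @maximal_lattice_exists _ _ pi K_complete _ _ _
  (scalesub (unif pi)^-1 A0) (x : V) irr.
- by apply: scalesub_lat => //; exact: invr_neq0.
- by rewrite /= invrK; exact: A0pi.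
- by rewrite /= invrK scalerKV.
have x0 : (x : V) != 0 by apply/eqP => x0; apply: nA0x; rewrite x0; exact: subrep0.
exists L; split; first by exists x.
have [/normalisedP[Lx nLx] _] := maxL.
have [_ _ _ _ fQ] := redmapP pi L.
have red0 : redmap pi L x <> 0 by move/fQ => h; apply: nLx; exact: h.
set S := soc (reduction pi L).
have [|Z simZ _] := @simple_over _ _ _ (subrep_zero _) (subrep_full (reduction pi L))
  (@red_artinian _ _ pi _ _ _ L) (fun _ _ => I).
  by move=> h; apply: red0; apply: h.
have [_ nZ0 _] := simZ.
(* Every nonzero subrepresentation contains the class of [x], so a simple [Z'] meets [Z] and lies in
   it. *)
have SE : Z = S :> set _.
  apply/seteqP; split; first exact: soc_simple.
  apply: soc_gen => Z' simZ'; have [_ nZ'0 sZ'] := simZ'.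
  have [||h|h] := sZ' (capsub Z' Z).
  - exact: subrep_zeroP.
  - exact: capsubl.
  - case: red0; apply: h; split; exact: maximal_in_subrep.
  - by move=> z /h[].
have irrS : irreducible (srep S) by apply/srep_irr; exact: simpleq_eq SE erefl simZ.
have isoS := redpre_iso (srep_iso S).
have simS : simpleq (redpre S) (redpre (subrep_zero (reduction pi L))).
  apply: (subquo_iso_irr (@residue_pi_surj _ _ pi) _ isoS irrS).
  by apply/redpre_le; exact: subrep_zeroP.
have Sx : redpre S x.
  by split=> //; rewrite -SE; exact: maximal_in_subrep.
(* Inside [V], both [A1 / A0] and the preimage of [S] modulo [pi L] are simple subquotients in which
   [x] has nonzero class. *)
have isoA : siso A1 A0 (srep S).
  apply: (subquo_iso_simple_transfer simA simS) isoS.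
    by move=> h; apply: nA0x; apply: h; split.
  set Q := redpre _.
  (* [A1] meet [pi L] contains [A0], because [L] contains [pi^-1 A0], and it misses [x]; simplicity
     puts it in [A0]. *)
  have [||h|h] := sA (capsub A1 Q).
  - move=> y A0y; split; first exact: A01.
    apply: pi_sub_redpre; apply: AL.
    by rewrite /= invrK scalerKV.
  - exact: capsubl.
  - by [].
  - by have [_ /redpre0] := h x A1x.
exact: (subquo_iso_unique (@residue_pi_surj _ _ pi) isoA iso).
Qed.

End Constituents.

Theorem theorem1p3 (K : fieldType) (v : dvaluation K)
  (K_complete : complete_valued v) (pi : uniformizer v)
  (G : topGroupType) (G_compact : compact [set: G])
  (V : vectType K) (rho : repn G V)
  (rho_continuous : continuous_repn v rho)
  (rho_irreducible : irreducible (Rep rho))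
  (r : nat) (W : 'I_r -> rep (residue pi) G) (m : 'I_r -> nat)
  (W_irreducible : forall i, irreducible (W i))
  (W_noniso : forall i j, riso (W i) (W j) -> i = j)
  (m_ge1 : forall i, (1 <= m i)%N)
  (rho_ss : riso (residual_ss pi rho) (dsum (fun i => rpow (W i) (m i)))) :
  [/\ forall i, exists L : stable_lattice v rho,
        maximal_lattice pi L /\ riso (srep (soc (reduction pi L))) (W i),
      forall (i : 'I_r) (L : stable_lattice v rho),
        maximal_lattice pi L -> riso (srep (soc (reduction pi L))) (W i) ->
        forall (j : 'I_r) (k : nat),
          occurs_in_level (W j) (reduction pi L) k ->
          bellaiche_path rho W i j k.-1
    & forall i j : 'I_r, exists k, bellaiche_path rho W i j k].
Proof.
split=> [i|i L _ isoS|i j].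
- exact: maximal_with_socle W_irreducible m_ge1 rho_ss i K_complete rho_irreducible.
- exact: soc_level_path W_irreducible m_ge1 rho_ss i L W_noniso isoS.
- have [L [_ isoS]] := maximal_with_socle W_irreducible m_ge1 rho_ss i K_complete rho_irreducible.
  have [k occ] := W_occurs_in_level W_irreducible m_ge1 rho_ss j L.
  exists k.-1; exact: soc_level_path W_irreducible m_ge1 rho_ss i L W_noniso isoS j k occ.
Qed.
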